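(* There exist two infinite trees $T$ and $S$, each of maximum degree three, such that $T$ and $S$ are both vertex-hypomorphic and edge-hypomorphic, and such that there is no embedding $T \hookrightarrow S$ and there is no embedding $S \hookrightarrow T$.
   Context: Two graphs $G$ and $H$ are vertex-hypomorphic if there exists a bijection $\varphi \colon V(G) \to V(H)$ such that the induced subgraphs $G - v$ and $H - \varphi(v)$ (obtained by deleting the vertex and its incident edges) are isomorphic for every $v \in V(G)$. They are edge-hypomorphic if there exists a bijection $\psi \colon E(G) \to E(H)$ such that $G - e \cong H - \psi(e)$ for every $e \in E(G)$, where $G-e$ is obtained from $G$ by deleting the edge $e$ and keeping all vertices. An embedding $G \hookrightarrow H$ is an injective map $V(G) \to V(H)$ sending adjacent vertices to adjacent vertices, i.e. an isomorphism of $G$ onto a subgraph of $H$. *)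

(* Defs.v *)
From mathcomp Require Import all_boot.
From mathcomp Require Import boolp classical_sets functions cardinality.

Set Implicit Arguments.
Unset Strict Implicit.
Unset Printing Implicit Defensive.

Local Open Scope classical_set_scope.
Local Open Scope card_scope.

(* Simple graphs, possibly infinite.  Boolean adjacency and decidable equality
   on vertices are no restriction, the classical axioms of boolp being available. *)
Record sgraph := SGraph {
  vertex :> eqType;
  adj : rel vertex;
  adj_sym : symmetric adj;
  adj_irr : irreflexive adj }.
Arguments adj {G} : rename.

Definition infinite_graph (G : sgraph) : Prop := infinite_set [set: G].

Definition connected_graph (G : sgraph) : Prop :=
  forall x y : G, exists2 p : seq G, path adj x p & y = last x p.

(* The bound on the size is needed: [:: x; y] is a ucycle whenever x and y are
   adjacent, and the empty sequence is always one. *)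
Definition acyclic_graph (G : sgraph) : Prop :=
  forall c : seq G, 2 < size c -> ~ ucycle adj c.

Definition is_tree (G : sgraph) : Prop :=
  [/\ inhabited G, connected_graph G & acyclic_graph G].

Definition neighbors (G : sgraph) (x : G) : set G := [set y | adj x y].

(* The maximum is attained: `I_d is a set with d elements. *)
Definition has_max_degree (G : sgraph) (d : nat) : Prop :=
  (forall x : G, neighbors x #<= `I_d) /\ (exists x : G, neighbors x #= `I_d).

Definition isomorphic (G H : sgraph) : Prop :=
  exists2 f : G -> H, bijective f & {mono f : x y / adj x y}.

(* Not required to be induced: non-adjacent vertices may become adjacent. *)
Definition embeds (G H : sgraph) : Prop :=
  exists2 f : G -> H, injective f & {homo f : x y / adj x y}.

Section Deletion.
Variable G : sgraph.

Section Vertex.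
Variable v : G.
Let D : eqType := {x : G | x != v}.
Definition del_vertex_adj : rel D := fun x y => adj (val x) (val y).
Fact del_vertex_sym : symmetric del_vertex_adj.
Proof. by move=> x y; apply: adj_sym. Qed.
Fact del_vertex_irr : irreflexive del_vertex_adj.
Proof. by move=> x; apply: adj_irr. Qed.
Definition del_vertex : sgraph := SGraph del_vertex_sym del_vertex_irr.
End Vertex.

(* An edge is the unordered pair of its endpoints. *)
Definition edges : set (set G) :=
  [set e | exists x y : G, adj x y /\ e = [set x; y]].

Section Edge.
Variable e : edges.
Definition del_edge_adj : rel G :=
  fun x y => adj x y && `[< [set x; y] <> \val e >].
Fact del_edge_sym : symmetric del_edge_adj.
Proof. by move=> x y; rewrite /del_edge_adj adj_sym setUC. Qed.
Fact del_edge_irr : irreflexive del_edge_adj.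
Proof. by move=> x; rewrite /del_edge_adj adj_irr. Qed.
Definition del_edge : sgraph := SGraph del_edge_sym del_edge_irr.
End Edge.

End Deletion.

Arguments edges G : clear implicits.

Definition vertex_hypomorphic (G H : sgraph) : Prop :=
  exists2 phi : G -> H, bijective phi &
    forall v : G, isomorphic (del_vertex v) (del_vertex (phi v)).

Definition edge_hypomorphic (G H : sgraph) : Prop :=
  exists2 psi : edges G -> edges H, bijective psi &
    forall e : edges G, isomorphic (del_edge e) (del_edge (psi e)).

(* Main.v *)
Require Import Defs.
From mathcomp Require Import all_boot zify.
From mathcomp Require Import boolp classical_sets functions cardinality.

(** Both trees have a spine, a ray with vertices of levels 0, 1, 2, ...  Cut the spines of
    [T] and [S] just below level [n], let [A_n] and [B_n] be the parts below the cut and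
    [U_n] and [W_n] the parts above it.  The trees are built such that, at suitable levels,

      [T  =  A_n -- t (U_{n+1}) -- q (W_{n+1}) -- B_n]   and
      [S  =  B_n -- s (W_{n+1}) -- q'(U_{n+1}) -- A_n'],

    where [A_n'] is [A_n] with the branch at one vertex [v_n] cut off and grafted onto the
    link between [A_n] and [q'].  Hence [T - v_n] is isomorphic to [S - w_n], where [w_n] is
    the root of the grafted branch, and similarly for the edges above [v_n] and [w_n].  At
    the other levels the roles of [T] and [S] are exchanged.  Since every vertex of [T]
    occurs as some [v_n], this gives injections between the vertices (and between the edges)
    of [T] and [S] which respect the isomorphism type of the deleted graph, and the
    Cantor-Bernstein argument makes them bijections.

    An embedding of [T] into [S] maps the vertices all of whose neighbours have degree 3 to
    such vertices, which makes it rigid along the spine of [T]: the image is a ray that is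
    eventually the spine of a copy of some [U_m] or [W_m].  The levels at which the rungs of
    a spine carry a graft form an aperiodic pattern, so this copy is a [U_m], entered without
    a shift of levels.  At the vertex where the ray enters the copy, the embedding would
    either lose a graft or map [A_n] into [A_n] minus a branch, fixing the root; the latter
    is impossible because the spheres of [A_n] are finite. *)

Set Implicit Arguments.
Unset Strict Implicit.
Unset Printing Implicit Defensive.

(** * Words and levels *)

Notation word := (seq bool).

Fixpoint wadj (u v : word) : bool :=
  match u, v with
  | [::], _ => size v == 1
  | a :: u', [::] => u' == [::]
  | a :: u', b :: v' => (a == b) && wadj u' v'
  end.

Lemma wadj_sym : symmetric wadj.
Proof.
elim=> [|a u IH] [|b v] //=; rewrite ?eqSS ?size_eq0 //.
by rewrite eq_sym IH.
Qed.

Lemma wadj_irr : irreflexive wadj.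
Proof. by elim=> [|a u IH] //=; rewrite eqxx. Qed.

Lemma wadj_cat p u v : wadj (p ++ u) (p ++ v) = wadj u v.
Proof. by elim: p => //= a p ->; rewrite eqxx. Qed.

Lemma wadj_rcons u b : wadj u (rcons u b).
Proof. by elim: u => //= a u ->; rewrite eqxx. Qed.

Lemma wadjP u v :
  reflect ((exists b, v = rcons u b) \/ (exists b, u = rcons v b)) (wadj u v).
Proof.
apply: (iffP idP) => [|[[b ->]|[b ->]]]; last 2 first.
- exact: wadj_rcons.
- by rewrite wadj_sym wadj_rcons.
elim: u v => [|a u IH] [|b v] //=.
- by case: v => // _; left; exists b.
- by move/eqP->; right; exists a.
- case/andP=> /eqP <- /IH[[d ->]|[d ->]]; [left|right]; by exists d.
Qed.

Lemma wadj_size u v : wadj u v -> size v = (size u).+1 \/ size u = (size v).+1.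
Proof. by case/wadjP=> -[b ->]; rewrite size_rcons; [left|right]. Qed.

Lemma prefix_wadj w u v : prefix w u -> ~~ prefix w v -> wadj u v ->
  w != [::] -> u = w /\ exists b, w = rcons v b.
Proof.
move=> pu pv /wadjP[[b ev]|[b eu]] wn0.
  by move: pv; rewrite ev -cats1 (prefix_trans pu) ?prefix_prefix.
suff e: u = w by split=> //; exists b; rewrite -e.
case/prefixP: pu => s; rewrite eu; case/lastP: s => [|s d]; first by rewrite cats0.
rewrite -rcons_cat => /rcons_inj[e _].
by move: pv; rewrite e prefix_prefix.
Qed.

(* At level [n] a branch of the tree of colour [col n] is regrafted; [target n] proposes
   its root.  As [col] is constant on the dyadic blocks, it is aperiodic. *)
Definition col (n : nat) : bool := odd (trunc_log 2 n).
Definition target (n : nat) : word :=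
  odflt [::] (unpickle (logn 2 (trunc_log 2 n)./2)).

Lemma col_block s n : 2 ^ s <= n < 2 ^ s.+1 -> col n = odd s.
Proof. by move=> h; rewrite /col (@trunc_log_eq 2 s n). Qed.

Lemma target_infinitely_often c u N :
  exists n, [/\ N <= n, col n = c & target n = u].
Proof.
(* The 2-adic valuation of [k] encodes [u], the odd factor makes [k] large without changing it, and
   the parity of the block index [c + k.*2] is the colour. *)
pose k := 2 ^ (pickle u) * N.*2.+1.
have logk : logn 2 k = pickle u.
  by rewrite /k lognM ?expn_gt0 // pfactorK // lognE /= dvdn2 /= odd_double /= addn0.
exists (2 ^ (c + k.*2)); rewrite /col /target trunc_expnK //; split.
- apply: leq_trans (ltnW (ltn_expl _ _)) => //.
  have : 0 < 2 ^ (pickle u) by rewrite expn_gt0.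
  rewrite /k; nia.
- by rewrite oddD odd_double addbF; case: c.
- by rewrite half_bit_double logk pickleK.
Qed.

Lemma exists_block c N : exists2 s, odd s = c & N < 2 ^ s.
Proof.
exists (N.*2 + c); first by rewrite oddD odd_double; case: c.
by apply: leq_ltn_trans (ltn_expl _ _) => //; rewrite -addnn; lia.
Qed.

(** Dyadic blocks outgrow any shift. A late block of colour [~~ c] contains both arguments for a
    suitable [i], whence [c' = c]; at the boundary between two late blocks a nonzero shift puts the
    arguments on opposite sides, where the colours differ. *)
Lemma col_shift c c' k l :
  (forall i, col (k + i) = ~~ c -> col (l + i) = ~~ c') -> c' = c /\ k = l.
Proof.
move=> H.
have ec : c' = c.
  have [s os hs] := exists_block (~~ c) (k + l).
  have e2 : 2 ^ s.+1 = 2 ^ s + 2 ^ s by rewrite expnS mul2n -addnn.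
  have ek : col (k + 2 ^ s) = odd s by apply: col_block; lia.
  have el : col (l + 2 ^ s) = odd s by apply: col_block; lia.
  by have := H (2 ^ s); rewrite ek el os => /(_ erefl) /negb_inj.
split=> //; rewrite ec in H.
case: (ltngtP k l) => // lt.
- have [s os hs] := exists_block (~~ c) (k + l).
  have e2 : 2 ^ s.+1 = 2 ^ s + 2 ^ s by rewrite expnS mul2n -addnn.
  have e3 : 2 ^ s.+2 = 2 ^ s.+1 + 2 ^ s.+1 by rewrite expnS mul2n -addnn.
  have ek : col (k + ((2 ^ s.+1).-1 - k)) = odd s by apply: col_block; lia.
  have el : col (l + ((2 ^ s.+1).-1 - k)) = odd s.+1 by apply: col_block; lia.
  by have := H ((2 ^ s.+1).-1 - k); rewrite ek el /= os negbK => /(_ erefl); case: (c).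
- have [s os hs] := exists_block c (k + l).
  have e2 : 2 ^ s.+1 = 2 ^ s + 2 ^ s by rewrite expnS mul2n -addnn.
  have e3 : 2 ^ s.+2 = 2 ^ s.+1 + 2 ^ s.+1 by rewrite expnS mul2n -addnn.
  have ek : col (k + (2 ^ s.+1 - k)) = odd s.+1 by apply: col_block; lia.
  have el : col (l + (2 ^ s.+1 - k)) = odd s by apply: col_block; lia.
  by have := H (2 ^ s.+1 - k); rewrite ek el /= os => /(_ erefl); case: (c).
Qed.

(** * Unfoldings of states *)

(* A state is the type of a rooted tree of words.  Colour [c] stands for one of the two
   trees.  [Up c n], [Sp c n], [Up c n.+1], ... is the spine of colour [c], and [Rg c n] is
   the rung below [Sp c n]; the trees [A_n] and [U_n] of the header are [Ar c n] and [Up c n]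
   for one colour, [B_n] and [W_n] for the other.  [Dn] links a hub to an [Ar]; [Gr n] is
   such a link with a stalk [St n], which carries the branch regrafted at level [n], and
   [Pr w q] is [q] without the branch at [w]. *)
Inductive state :=
| Root of bool | Base of bool
| Up of bool & nat | Sp of bool & nat | Rg of bool & nat
| Dn of bool & nat | Ar of bool & nat
| Lf | Gr of nat | St of nat
| Pr of word & state.

Section Unfolding.
Variable E : nat -> option (word * state).

Fixpoint step (q : state) (b : bool) : option state :=
  match q with
  | Root c => if b then Some (Base c) else None
  | Base c => Some (if b then Up c 0 else Lf)
  | Up c n => Some (if b then Sp c n else Lf)
  | Sp c n => Some (if b then Up c n.+1 else Rg c n)
  | Rg c n => Some (if b then Up (~~ c) n.+1
                    else if col n == ~~ c then Gr n else Dn (~~ c) n)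
  | Dn c n => Some (if b then Ar c n else Lf)
  | Ar c n => Some (if n is m.+1 then if b then Dn c m else Rg c m else Lf)
  | Lf => None
  | Gr n => if b then omap (fun e => Pr e.1 (Ar (col n) n)) (E n) else Some (St n)
  | St n => if b then None else omap snd (E n)
  | Pr w q => if w is a :: w' then
                if a == b then if w' == [::] then None else omap (Pr w') (step q b)
                else step q b
              else step q b
  end.

Fixpoint run (q : state) (u : word) : option state :=
  if u is b :: u' then obind (run^~ u') (step q b) else Some q.

Definition addr (q : state) (u : word) : bool := isSome (run q u).

Lemma run_cat q u v : run q (u ++ v) = obind (run^~ v) (run q u).
Proof. by elim: u q => //= b u IH q; case: (step q b). Qed.

Lemma run_rcons q u b : run q (rcons u b) = obind (step^~ b) (run q u).
Proof. by rewrite -cats1 run_cat; case: (run q u) => //= p; case: (step p b). Qed.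

Lemma addr_catl q u v : addr q (u ++ v) -> addr q u.
Proof. by rewrite /addr run_cat; case: (run q u). Qed.

Lemma addr_rconsl q u b : addr q (rcons u b) -> addr q u.
Proof. by rewrite -cats1; apply: addr_catl. Qed.

Lemma addr_Pr w q u : w != [::] -> addr (Pr w q) u = addr q u && ~~ prefix w u.
Proof.
elim: u w q => [|b u IH] [|a w] q //= _; rewrite /addr /=.
case: (a == b) => /=; last by rewrite andbT.
case: eqP => [->|/eqP w0] /=; first by rewrite prefix0s andbF.
by case: (step q b) => //= p; apply: IH.
Qed.

(** * Spine vertices, and addresses in the part below a cut *)

Definition sp n : word := nseq n.*2.+2 true.
Arguments sp : simpl never.

Lemma spS n : sp n.+1 = sp n ++ [:: true; true].
Proof. by rewrite /sp -[[:: true; true]]/(nseq 2 true) -nseqD addn2. Qed.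

Lemma size_sp n : size (sp n) = n.*2.+2.
Proof. by rewrite size_nseq. Qed.

Lemma run_sp c n u : run (Root c) (sp n ++ u) = run (Up c n) u.
Proof. by elim: n u => // n IH u; rewrite spS -catA IH. Qed.

Lemma addr_sp c n u : addr (Root c) (sp n ++ u) = addr (Up c n) u.
Proof. by rewrite /addr run_sp. Qed.

Lemma prefix_cat2 (p u v : word) : prefix (p ++ u) (p ++ v) = prefix u v.
Proof. by elim: p => //= a p ->; rewrite eqxx. Qed.

(* [Ar c n] describes the part of the tree [Root c] below the vertex [sp n],
   rooted at the neighbour of [sp n]; [al] and [be] translate the addresses. *)
Fixpoint al n (u : word) : word :=
  match n, u with
  | 0, [::] => [:: true]
  | 0, false :: _ => [:: true; false]
  | 0, true :: _ => [::]
  | m.+1, true :: true :: u' => al m u'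
  | m.+1, true :: u' => sp m ++ u'
  | m.+1, _ => sp m ++ true :: u
  end.

Fixpoint be n (v : word) : word :=
  if n is m.+1 then
    if prefix (sp m) v then
      let z := drop (size (sp m)) v in if z is true :: z' then z' else true :: z
    else [:: true, true & be m v]
  else match v with [::] => [:: true] | [:: _] => [::] | _ => [:: false] end.

Lemma addr_al c n u : addr (Ar c n) u -> addr (Root c) (al n u).
Proof.
elim: n u => [|n IH] [|[] u] //=; try by rewrite addr_sp.
case: u => [|[] u] //; [by rewrite addr_sp|exact: IH|by rewrite addr_sp].
Qed.

Lemma al_prefix c n u : addr (Ar c n) u -> ~~ prefix (sp n) (al n u).
Proof.
elim: n u => [|n IH] [|[] u] //; rewrite ?[al _ _]/= spS ?prefix_cat2 //.
case: u => [|[] u] //; rewrite ?prefix_cat2 // => /IH /negP h.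
by apply/negP => /prefixP[s e]; apply: h; rewrite e -!catA prefix_prefix.
Qed.

Lemma be_al c n u : addr (Ar c n) u -> be n (al n u) = u.
Proof.
elim: n u => [|n IH] [|[] u] //.
- by case: u.
- by case: u.
- by rewrite /= prefix_prefix drop_size_cat.
- case: u => [|[] u] //=; rewrite ?prefix_prefix ?drop_size_cat // => h.
  by rewrite (negPf (@al_prefix c n u h)) IH.
- by rewrite /= prefix_prefix drop_size_cat.
Qed.

Lemma be_domain c n v : addr (Root c) v -> ~~ prefix (sp n) v ->
  addr (Ar c n) (be n v) /\ al n (be n v) = v.
Proof.
elim: n v => [|n IH] v.
  by rewrite /sp; case: v => [|[] [|[] [|? v]]].
move=> mv; rewrite [be _ _]/=.
case: ifP => [/prefixP[z ev]|/negbT pv _]; last by have [] := IH _ mv pv.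
move: mv; rewrite ev addr_sp drop_size_cat // spS prefix_cat2.
by case: z ev => [|[] [|[] z]] //= _ _; rewrite prefix0s.
Qed.

Lemma wadj_al_sp c n u z : addr (Ar c n) u ->
  wadj (al n u) (sp n ++ z) = (u == [::]) && (z == [::]).
Proof.
elim: n u z => [|n IH] [|[] u] z //.
- by rewrite /sp; case: z.
- by rewrite spS -catA wadj_cat; case: z.
- rewrite spS -catA; case: u => [|[] u] //=; rewrite ?wadj_cat //.
  by move=> h; rewrite IH // andbF.
- by rewrite spS -catA wadj_cat.
Qed.

Lemma wadj_al c n u v : addr (Ar c n) u -> addr (Ar c n) v ->
  wadj (al n u) (al n v) = wadj u v.
Proof.
elim: n u v => [|n IH] u v.
  by case: u => [|[] [|? u]] //; case: v => [|[] [|? v]].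
have H u' z : addr (Ar c n) u' -> wadj (sp n ++ z) (al n u') = (u' == [::]) && (z == [::]).
  by move=> h; rewrite wadj_sym (@wadj_al_sp c).
have H1 u' z : addr (Ar c n) u' -> wadj (al n u') (sp n ++ z) = (u' == [::]) && (z == [::]).
  exact: wadj_al_sp.
case: u => [|[] [|[] u]] //; case: v => [|[] [|[] v]] // hu hv; cbn [al];
  rewrite ?wadj_cat ?H1 ?H ?IH // ?andbF ?andbT //;
  by [case: (v) | case: (u)].
Qed.

End Unfolding.

(** * The grafted branches *)

Lemma step_mono E E' q b p : (forall m e, E m = Some e -> E' m = Some e) ->
  step E q b = Some p -> step E' q b = Some p.
Proof.
move=> sub; elim: q p => //= [n|n|w q IH] p.
- by case: b => //; case En: (E n) => [e|] //; rewrite (sub _ _ En).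
- by case: b => //; case En: (E n) => [e|] //; rewrite (sub _ _ En).
- case: w => [|a w]; first exact: IH.
  case: ifP => _; last exact: IH.
  by case: ifP => // _; case: (step E q b) IH => // q' IH; rewrite (IH q').
Qed.

Lemma run_mono E E' q u p : (forall m e, E m = Some e -> E' m = Some e) ->
  run E q u = Some p -> run E' q u = Some p.
Proof.
move=> sub; elim: u q => //= b u IH q; case e: (step E q b) => [q'|] //=.
by rewrite (step_mono sub e); apply: IH.
Qed.

(* The data of level [n] may only refer to the tables of lower levels: otherwise
   the grafted subtrees could be defined in terms of each other. *)
Definition entry n (E : nat -> option (word * state)) : word * state :=
  let w := be n (target n) in
  if ~~ prefix (sp n) (target n) && (w != [::]) && addr E (Ar (col n) n) w
  then (w, odflt Lf (run E (Ar (col n) n) w))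
  else ([:: false], if n is m.+1 then Rg (col n) m else Lf).

Fixpoint tb n (m : nat) : option (word * state) :=
  if n is n'.+1 then if m == n' then Some (entry n' (tb n')) else tb n' m else None.

Definition cut n : word := (entry n (tb n)).1.
Definition stem n : state := (entry n (tb n)).2.
Definition tab n : option (word * state) := Some (cut n, stem n).

Lemma tb_lt m n : m < n -> tb n m = tab m.
Proof.
elim: n => //= n IH; rewrite ltnS leq_eqVlt; case: eqP => [-> _|_ /= /IH] //.
by rewrite /tab /cut /stem; case: entry.
Qed.

Lemma tb_sub n m e : tb n m = Some e -> tab m = Some e.
Proof.
case: (ltnP m n) => [/tb_lt -> //|]; elim: n => //= n IH lt.
by case: eqP lt => [->|_ /ltnW]; [rewrite ltnn|apply: IH].
Qed.

Lemma step_tb q b : exists N, forall n, N <= n -> step (tb n) q b = step tab q b.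
Proof.
elim: q => [c|c|c n|c n|c n|c n|c n||n|n|w q [N IH]]; try by exists 0.
- by exists n.+1 => m h; rewrite /= tb_lt.
- by exists n.+1 => m h; rewrite /= tb_lt.
- by exists N => n h; rewrite /= IH.
Qed.

(** A run along a finite word consults finitely many entries. Hence every vertex of the final tree
    is already visible to all late finite tables, the only ones that [entry] may use. *)
Lemma run_tb q u : exists N, forall n, N <= n -> run (tb n) q u = run tab q u.
Proof.
elim: u q => [|b u IH] q; first by exists 0.
have [N HN] := step_tb q b.
case e: (step tab q b) => [p|]; last by exists N => n h; rewrite /= HN // e.
have [M HM] := IH p; exists (maxn N M) => n; rewrite geq_max => /andP[h1 h2].
by rewrite /= HN // e /= HM.
Qed.

Lemma cut_neq0 n : cut n != [::].
Proof. by rewrite /cut /entry; case: ifP => // /andP[/andP[]]. Qed.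

(** Both branches of [entry] describe a real vertex: a run in a finite table persists in [tab], and
    the default [[:: false]] is the left child of the root of [Ar (col n) n], recorded with its true
    state. *)
Lemma run_cut n : run tab (Ar (col n) n) (cut n) = Some (stem n).
Proof.
rewrite /cut /stem /entry; case: ifP => [/andP[_ /=]|_ /=].
  rewrite /addr; case e: (run _ _ _) => [q|] //= _.
  by apply: run_mono e => m e; apply: tb_sub.
by case: n.
Qed.

(** Each word is proposed at arbitrarily late levels of each colour, and a late enough table
    contains the run to [u], so [entry] accepts the proposal. *)
Lemma cut_target c u N : addr tab (Root c) u ->
  exists n, [/\ N <= n, col n = c, ~~ prefix (sp n) u & cut n = be n u].
Proof.
move=> mu; have [M HM] := run_tb (Root c) u.
have [[|n] [le en et]] := target_infinitely_often c u (N + M + size u).+1 => //.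
(* Missing the prefix already at level [n] makes [be n.+1 u] start with two letters, hence nonempty
   as [entry] demands. *)
have pu : ~~ prefix (sp n) u.
  by apply/negP => /prefixP[s es]; move: le; rewrite es size_cat size_sp; lia.
have pu' : ~~ prefix (sp n.+1) u.
  by apply/negP => /prefixP[s es]; move: le; rewrite es size_cat size_sp; lia.
exists n.+1; split=> //; first lia.
rewrite /cut /entry et pu' en.
have -> : addr (tb n.+1) (Ar c n.+1) (be n.+1 u).
  by have [] := @be_domain (tb n.+1) c n.+1 u _ pu'; rewrite // /addr HM //; lia.
by rewrite andbT /= (negPf pu).
Qed.

(** * The two trees *)

Local Open Scope classical_set_scope.
Local Open Scope card_scope.

Notation vtx c := {u : word | addr tab (Root c) u}.

Definition tadj c : rel (vtx c) := fun x y => wadj (val x) (val y).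
Fact tadj_sym c : symmetric (@tadj c).
Proof. by move=> x y; apply: wadj_sym. Qed.
Fact tadj_irr c : irreflexive (@tadj c).
Proof. by move=> x; apply: wadj_irr. Qed.

Definition tree c : sgraph := SGraph (@tadj_sym c) (@tadj_irr c).

Definition vertex_at c u (h : addr tab (Root c) u) : tree c := Sub u h.

Definition spv c n : tree c :=
  exist _ (sp n) (etrans (congr1 (addr tab (Root c)) (esym (cats0 (sp n)))) (addr_sp tab c n [::])).

Lemma tree_inhabited c : inhabited (tree c).
Proof. exact: (inhabits (spv c 0)). Qed.

Lemma tree_connected c : connected_graph (tree c).
Proof.
pose r : tree c := exist _ [::] isT.
have to_root : forall (n : nat) (x : tree c), size (val x) = n ->
    (exists2 p : seq (tree c), path adj x p & r = last x p) /\
    (exists2 p : seq (tree c), path adj r p & x = last r p).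
  elim=> [|n IH] [u hu] /= su.
    have e : exist _ u hu = r by apply: val_inj; apply: size0nil.
    by rewrite e; split; exists [::].
  case/lastP: u hu su => // u b hu; rewrite size_rcons => -[su].
  have [[p pp lp] [s ps ls]] := IH (exist _ u (addr_rconsl hu)) su.
  split.
    exists (exist _ u (addr_rconsl hu) :: p) => //=.
    by rewrite pp andbT; change (wadj (rcons u b) u); rewrite wadj_sym wadj_rcons.
  exists (rcons s (exist _ (rcons u b) hu)); last by rewrite last_rcons.
  by rewrite rcons_path ps -ls; apply: wadj_rcons.
move=> x y; have [[p pp lp] _] := to_root _ x erefl.
have [_ [s ps ls]] := to_root _ y erefl.
by exists (p ++ s); rewrite ?cat_path ?last_cat -lp ?pp ?ps.
Qed.

Lemma exists_max_in (I : eqType) (F : I -> nat) (s : seq I) : s != [::] ->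
  exists2 x, x \in s & forall y, y \in s -> F y <= F x.
Proof.
elim: s => // x [|z s] IH _; first by exists x => [|y]; rewrite inE // => /eqP ->.
have [y ys ym] := IH isT; case: (leqP (F x) (F y)) => le.
  by exists y => [|w]; rewrite inE ?ys ?orbT // => /orP[/eqP ->|/ym].
exists x => [|w]; rewrite inE ?eqxx // => /orP[/eqP ->|/ym] // h.
exact: leq_trans h (ltnW le).
Qed.

(** Both neighbours in the cycle of a longest word are shorter, so each is its parent, and they
    coincide. *)
Lemma tree_acyclic c : acyclic_graph (tree c).
Proof.
move=> s size_s cyc.
have [x xs xmax] : exists2 x, x \in s & forall y, y \in s -> size (val y) <= size (val x).
  by apply: exists_max_in; case: (s) size_s.
case: (rot_to xs) => i s' e.
have : ucycle adj (x :: s') by rewrite -e rot_ucycle.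
have size_s' : 2 < size (x :: s') by rewrite -e size_rot.
have xmax' y : y \in s' -> size (val y) <= size (val x).
  by move=> ys; apply: xmax; rewrite -(mem_rot i) e inE ys orbT.
case: s' {e} size_s' xmax' => // y s'; case/lastP: s' => // s' z _ xmax'.
rewrite /ucycle /= rcons_path last_rcons => /andP[/andP[xy /andP[_ zx]] /andP[_ /andP[yz _]]].
case/negP: yz; rewrite mem_rcons inE; apply/orP; left; apply/eqP/val_inj.
have sy : size (val y) <= size (val x) by apply: xmax'; rewrite inE eqxx.
have sz : size (val z) <= size (val x) by apply: xmax'; rewrite inE mem_rcons inE eqxx orbT.
case/wadjP: xy => -[a ea]; first by move: sy; rewrite ea size_rcons ltnn.
case/wadjP: zx => -[b eb]; last by move: sz; rewrite eb size_rcons ltnn.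
by move: ea; rewrite eb => /rcons_inj[].
Qed.

Lemma tree_is_tree c : is_tree (tree c).
Proof. by split; [exact: tree_inhabited|exact: tree_connected|exact: tree_acyclic]. Qed.

Lemma tree_infinite c : infinite_graph (tree c).
Proof.
apply/infiniteP.
have : range (spv c) #= [set: nat].
  apply: inj_card_eq => m n _ _ e.
  have : size (sp m) = size (sp n) := congr1 (fun x : tree c => size (val x)) e.
  by rewrite !size_sp => -[] /double_inj.
move/card_esym; rewrite card_eq_le => /andP[h _].
by apply: (card_le_trans h); apply: subset_card_le.
Qed.

(** Labels that separate the neighbours [v] of [u]: parent, right child, left child. *)
Definition side (u v : word) : nat :=
  if size v < size u then 0 else if last false v then 1 else 2.

Lemma side_lt u v : side u v < 3.
Proof. by rewrite /side; case: ifP => // _; case: ifP. Qed.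

Lemma side_inj u v w : wadj u v -> wadj u w -> side u v = side u w -> v = w.
Proof.
rewrite /side => /wadjP[][a ea] /wadjP[][b eb].
- by rewrite ea eb !size_rcons !last_rcons ltnNge leqnSn /=; case: a {ea}; case: b {eb}.
- have -> : size v < size u = false by rewrite ea size_rcons ltnNge leqnSn.
  by rewrite [X in size w < X](congr1 size eb) size_rcons ltnSn; case: ifP.
- have -> : size w < size u = false by rewrite eb size_rcons ltnNge leqnSn.
  by rewrite [X in size v < X](congr1 size ea) size_rcons ltnSn; case: ifP.
- by rewrite eb in ea; case/rcons_inj: ea.
Qed.

Lemma tree_degree c : has_max_degree (tree c) 3.
Proof.
pose g (x y : tree c) := side (val x) (val y).
have ginj x : {in neighbors x &, injective (g x)}.
  move=> y z; rewrite !inE => xy xz e; apply: val_inj; exact: side_inj xy xz e.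
split.
  move=> x; have := card_esym (inj_card_eq (ginj x)); rewrite card_eq_le => /andP[h _].
  apply: (card_le_trans h); apply: subset_card_le => _ [y _ <-] /=; exact: side_lt.
pose x := spv c 0; exists x.
have /card_esym h := inj_card_eq (ginj x); apply: (card_eq_trans h).
suff -> : [set g x y | y in neighbors x] = `I_3 by [].
apply/seteqP; split => [_ [y _ <-]|]; first exact: side_lt.
have h0 : addr tab (Root c) [:: true] by [].
have h1 : addr tab (Root c) [:: true; true; true] by [].
have h2 : addr tab (Root c) [:: true; true; false] by [].
move=> [|[|[|//]]] _.
- by exists (Sub _ h0 : tree c).
- by exists (Sub _ h1 : tree c).
- by exists (Sub _ h2 : tree c).
Qed.

(** * Regrafting and hypomorphism *)

Lemma isomorphic_sym G H : isomorphic G H -> isomorphic H G.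
Proof.
case=> f [g fK gK] fadj; exists g; first by exists f.
by move=> x y; rewrite -fadj !gK.
Qed.

(** The Cantor-Bernstein bijection agrees at each point with [f] or with an inverse of [g], so it
    inherits a relation respected by both. *)
Lemma cantor_bernstein_rel (A B : Type) (P : A -> B -> Prop) (f : A -> B) (g : B -> A) :
    injective f -> injective g -> (forall a, P a (f a)) -> (forall b, P (g b) b) ->
  exists2 h : A -> B, bijective h & forall a, P a (h a).
Proof.
move=> finj ginj Pf Pg.
(* [C a] holds when the backward orbit of [a] stops in [A] outside the range of [g]. *)
pose C a := exists n a0, (forall b, g b <> a0) /\ a = iter n (g \o f) a0.
have notC a : ~ C a -> exists b, g b = a.
  move=> nC; apply: contrapT => nb; apply: nC; exists 0, a; split=> // b e.
  by apply: nb; exists b.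
have /choice[h hP] : forall a, exists b, (C a /\ b = f a) \/ (~ C a /\ g b = a).
  move=> a; case: (pselect (C a)) => ca; first by exists (f a); left.
  by have [b e] := notC _ ca; exists b; right.
have /choice[k kP] : forall b, exists a, h a = b.
  move=> b; case: (pselect (C (g b))) => [[[|n] [a0 [na e]]]|cb].
  - by case: (na b).
  - exists (iter n (g \o f) a0); case: (hP (iter n (g \o f) a0)) => [[_ ->]|[nC _]].
      by apply: ginj; rewrite e.
    by case: nC; exists n, a0.
  - exists (g b); case: (hP (g b)) => [[]|[_ /ginj]] //.
have hinj : injective h.
  move=> a a' e; case: (hP a) (hP a') => [[ca ea]|[ca ea]] [[ca' ea']|[ca' ea']].
  - by apply: finj; rewrite -ea -ea'.
  - case: ca' ; case: ca => n [a0 [na an]]; exists n.+1, a0; split=> //.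
    by rewrite -ea' -e ea an.
  - case: ca ; case: ca' => n [a0 [na an]]; exists n.+1, a0; split=> //.
    by rewrite -ea e ea' an.
  - by rewrite -ea -ea' e.
exists h; first by exists k => // a; apply: hinj; rewrite kP.
by move=> a; case: (hP a) => [[_ ->]//|[_ {1}<-]].
Qed.

Definition same_edge (I : eqType) (x y a b : I) :=
  (x == a) && (y == b) || (x == b) && (y == a).

Lemma same_edgeP (I : eqType) (x y a b : I) :
  reflect ([set x; y] = [set a; b]) (same_edge x y a b).
Proof.
apply: (iffP idP) => [/orP[/andP[/eqP -> /eqP ->]|/andP[/eqP -> /eqP ->]]|e] //.
  by rewrite setUC.
have hx : [set a; b] x by rewrite -e; left.
have hy : [set a; b] y by rewrite -e; right.
have ha : [set x; y] a by rewrite e; left.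
have hb : [set x; y] b by rewrite e; right.
by rewrite /same_edge; case: hx hy ha hb => /= ex [] ey [] ea [] eb; subst; rewrite !eqxx ?orbT.
Qed.

Definition edge_of (G : sgraph) (x y : G) (h : adj x y) : edges G :=
  SigSub (mem_set (ex_intro _ x (ex_intro _ y (conj h erefl)))).

Section Regraft.
Variables (G H : sgraph) (f : G -> H) (v p : G) (v' p' : H).
Hypotheses (fbij : bijective f) (fv : f v = v').
Hypotheses (vp : adj v p) (vp' : adj v' p').
Hypothesis fadj : forall x y, adj x y && ~~ same_edge x y v p =
  adj (f x) (f y) && ~~ same_edge (f x) (f y) v' p'.

(** The exempted edge has [v] as an end, so it disappears with [v], and [f] preserves all
    adjacencies that remain. *)
Lemma regraft_vertex : isomorphic (del_vertex v) (del_vertex v').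
Proof.
case: fbij => g fK gK.
have fD (x : {x | x != v}) : f (val x) != v' by rewrite -fv (inj_eq (can_inj fK)) (valP x).
have gD (y : {y | y != v'}) : g (val y) != v.
  by apply: contra (valP y) => /eqP e; rewrite -(gK (val y)) e fv.
exists (fun x : del_vertex v => exist _ (f (val x)) (fD x) : del_vertex v').
  exists (fun y : del_vertex v' => exist _ (g (val y)) (gD y) : del_vertex v) => x;
    apply: val_inj => /=.
    by rewrite fK.
  by rewrite gK.
move=> x y; rewrite /= /del_vertex_adj /=.
have := fadj (val x) (val y); rewrite /same_edge.
rewrite (negPf (valP x)) (negPf (valP y)) (negPf (fD x)) (negPf (fD y)) /= !andbF /=.
by rewrite !andbT.
Qed.

Lemma regraft_edge : isomorphic (del_edge (edge_of vp)) (del_edge (edge_of vp')).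
Proof.
exists f => // x y; rewrite /= /del_edge_adj /=.
have E (I : eqType) (a b c d : I) : `[< [set a; b] <> [set c; d] >] = ~~ same_edge a b c d.
  by apply/asboolP/idP => [h|/same_edgeP//]; apply/same_edgeP.
by rewrite !E fadj.
Qed.

End Regraft.

(* Coordinates for the decomposition of [tree c] at level [n] into the rooted trees
   [Ar c n] (left) and [Up c n] (right), whose roots are joined by an edge. *)
Notation coord := (word + word)%type.

Definition jaddr c n (j : coord) :=
  match j with inl u => addr tab (Ar c n) u | inr u => addr tab (Up c n) u end.

Definition jadj (j k : coord) : bool :=
  match j, k with
  | inl u, inl v | inr u, inr v => wadj u v
  | inl u, inr v | inr v, inl u => (u == [::]) && (v == [::])
  end.

Definition ofj n (j : coord) : word :=
  match j with inl u => al n u | inr u => sp n ++ u end.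

Definition toj n (v : word) : coord :=
  if prefix (sp n) v then inr (drop (size (sp n)) v) else inl (be n v).

Lemma jadj_sym : symmetric jadj.
Proof. by move=> [u|u] [v|v] //=; apply: wadj_sym. Qed.

Lemma addr_ofj c n j : jaddr c n j -> addr tab (Root c) (ofj n j).
Proof. by case: j => u; [apply: addr_al|rewrite /= addr_sp]. Qed.

Lemma ofjK c n j : jaddr c n j -> toj n (ofj n j) = j.
Proof.
case: j => u h; last by rewrite /toj /ofj prefix_prefix drop_size_cat.
by rewrite /toj /ofj (negPf (al_prefix h)) (be_al h).
Qed.

Lemma toj_domain c n v : addr tab (Root c) v -> jaddr c n (toj n v) /\ ofj n (toj n v) = v.
Proof.
rewrite /toj; case: ifP => [/prefixP[s ->]|/negbT]; last by move=> pv h; exact: be_domain.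
by rewrite drop_size_cat //= addr_sp.
Qed.

Lemma wadj_ofj c n j k : jaddr c n j -> jaddr c n k -> wadj (ofj n j) (ofj n k) = jadj j k.
Proof.
case: j k => [u|u] [v|v] hu hv; rewrite /ofj.
- exact: wadj_al hu hv.
- exact: wadj_al_sp hu.
- by rewrite wadj_sym (wadj_al_sp _ hv).
- exact: wadj_cat.
Qed.

(* Deleting the edge above the vertex [cut n] of [Ar c n] in [tree c], and the edge below
   [St n] in [tree (~~ c)], where [c = col n], leaves two isomorphic forests. *)
Definition swap n (j : coord) : coord :=
  match j with
  | inl u => if prefix (cut n) u
             then inr ([:: true; false; false; false; false] ++ drop (size (cut n)) u)
             else inr ([:: true; false; false; true] ++ u)
  | inr [::] => inr [:: true; false; false]
  | inr (false :: u) => inr [:: true, false, false, false & u]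
  | inr [:: true] => inr [:: true; false]
  | inr [:: true; false] => inr [:: true]
  | inr [:: true, true & u] => inr [:: true, false, true & u]
  | inr [:: true, false, true & u] => inr [:: true, true & u]
  | inr [:: true; false; false] => inr [::]
  | inr [:: true, false, false, true & u] => inl u
  | inr [:: true, false, false, false & u] => inr (false :: u)
  end.

(** Below the stalk only the letter [false] leads to a vertex, so the last clause may ignore this
    letter. *)
Definition swap_inv n (j : coord) : coord :=
  match j with
  | inl u => inr [:: true, false, false, true & u]
  | inr [::] => inr [:: true; false; false]
  | inr (false :: u) => inr [:: true, false, false, false & u]
  | inr [:: true] => inr [:: true; false]
  | inr [:: true; false] => inr [:: true]
  | inr [:: true, true & u] => inr [:: true, false, true & u]
  | inr [:: true, false, true & u] => inr [:: true, true & u]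
  | inr [:: true; false; false] => inr [::]
  | inr [:: true, false, false, true & u] => inl u
  | inr [:: true; false; false; false] => inr [:: false]
  | inr [:: true, false, false, false, _ & u] => inl (cut n ++ u)
  end.

Lemma addr_stem n u : addr tab (stem n) u = addr tab (Ar (col n) n) (cut n ++ u).
Proof. by rewrite /addr run_cat run_cut. Qed.

Lemma addr_graft n u : addr tab (Up (~~ col n) n) [:: true, false, false & u] =
  addr tab (Gr n) u.
Proof. by rewrite /addr /= negbK eqxx. Qed.

Lemma addr_nograft n u : addr tab (Up (col n) n) [:: true, false, false & u] =
  addr tab (Dn (~~ col n) n) u.
Proof. by rewrite /addr /=; case: (col n). Qed.

Lemma swap_jaddr n j : jaddr (col n) n j -> jaddr (~~ col n) n (swap n j).
Proof.
case: j => [u|[|[] [|[] [|[] u]]]] //=.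
- case: ifP => [/prefixP[s ->] h|/negbT pu h].
    rewrite drop_size_cat // /jaddr (addr_graft n).
    by rewrite -[addr _ _ _]/(addr tab (stem n) s) addr_stem.
  rewrite /jaddr (addr_graft n) -[addr _ _ _]/(addr tab (Pr (cut n) (Ar (col n) n)) u).
  by rewrite addr_Pr ?cut_neq0 // h.
all: try by rewrite /addr /= ?negbK.
- by case: u => [|[] u] //; rewrite (addr_nograft n).
- by rewrite (addr_graft n).
Qed.

Lemma swap_inv_jaddr n j : jaddr (~~ col n) n j -> jaddr (col n) n (swap_inv n j).
Proof.
case: j => [u|[|[] [|[] [|[] u]]]] //=; try by rewrite /addr /= ?negbK.
- by rewrite (addr_nograft n).
- case: u => [|[] [|b u]] //; rewrite (addr_graft n) //.
  + rewrite -[addr _ _ _]/(addr tab (Pr (cut n) (Ar (col n) n)) (b :: u)).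
    by rewrite addr_Pr ?cut_neq0 // => /andP[].
  + case: b => //; rewrite -[addr _ _ _]/(addr tab (stem n) u).
    by rewrite addr_stem.
- by rewrite (addr_nograft n).
Qed.

Lemma swapK n j : jaddr (col n) n j -> swap_inv n (swap n j) = j.
Proof.
case: j => [u|[|[] [|[] [|[] u]]]] //=.
  by case: ifP => // /prefixP[s ->]; rewrite drop_size_cat.
by case: u => [|[] [|[] u]] //; rewrite (addr_nograft n).
Qed.

Lemma swap_invK n j : jaddr (~~ col n) n j -> swap n (swap_inv n j) = j.
Proof.
case: j => [u|[|[] [|[] [|[] u]]]] //=.
case: u => [|[] u] //; rewrite (addr_graft n).
  by rewrite -[addr _ _ _]/(addr tab (Pr (cut n) (Ar (col n) n)) u) addr_Pr ?cut_neq0 // =>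
    /andP[_ /negPf pu] /=; rewrite pu.
by case: u => [|[] u] //= _; rewrite prefix_prefix drop_size_cat.
Qed.

Lemma same_edgeC (I : eqType) (x y a b : I) : same_edge x y a b = same_edge y x a b.
Proof. by rewrite /same_edge orbC andbC [X in _ || X]andbC. Qed.

Lemma coord_eqE : ((forall u v : word, (inl u == inl v :> coord) = (u == v)) *
  (forall u v : word, (inr u == inr v :> coord) = (u == v)) *
  (forall u v : word, (inl u == inr v :> coord) = false) *
  (forall u v : word, (inr u == inl v :> coord) = false))%type.
Proof. by []. Qed.

(** The link at [sp n] becomes the link [Gr n] and its leaf the stalk; the spine vertex after it and
    the rung there become rung and spine vertex of the other tree. Only the branch at the cut
    changes its neighbour, moving below the stalk. *)
Lemma jadj_swap n w b j k : cut n = rcons w b ->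
    jaddr (col n) n j -> jaddr (col n) n k ->
  jadj j k && ~~ same_edge j k (inl (cut n)) (inl w) =
  jadj (swap n j) (swap n k) &&
  ~~ same_edge (swap n j) (swap n k) (inr [:: true; false; false; false; false])
       (inr [:: true; false; false; false]).
Proof.
move=> ecut.
pose good j k := jadj j k && ~~ same_edge j k (inl (cut n)) (inl w) =
  jadj (swap n j) (swap n k) &&
  ~~ same_edge (swap n j) (swap n k) (inr [:: true; false; false; false; false])
       (inr [:: true; false; false; false]).
have good_sym j' k' : good j' k' -> good k' j'.
  by rewrite /good jadj_sym same_edgeC [in RHS]jadj_sym [in RHS]same_edgeC.
have sw : size (cut n) = (size w).+1 by rewrite ecut size_rcons.
(* The only edge leaving the branch is the exempted one. *)
have mixed u v : prefix (cut n) u -> ~~ prefix (cut n) v -> good (inl u) (inl v).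
  move=> pu pv; rewrite /good /= pu (negPf pv) /same_edge !coord_eqE.
  case uv: (wadj u v) => //=.
  have [-> [b' e]] := prefix_wadj pu pv uv (cut_neq0 n).
  by move: e; rewrite ecut => /rcons_inj[-> _]; rewrite !eqxx.
have left_right u v : jaddr (col n) n (inr v) -> good (inl u) (inr v).
  move=> hv; rewrite /good /= /same_edge !coord_eqE /= !andbF /= andbT.
  case: ifP => [/prefixP[s ->]|_].
    rewrite drop_size_cat //; case ec: (cut n) (cut_neq0 n) => [//|a c'] _ /=.
    case: v hv => [|[] [|[] [|[] v]]] //=; try by case: s.
    by case: v => [|[] v]; rewrite ?andbF.
  case: v hv => [|[] [|[] [|[] v]]] //=; try by case: u.
  by case: v => [|[] v]; rewrite ?andbF.
(* Both patterns start at a leaf of [Up (col n) n], so nothing continues them. *)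
have tail_nil u : jaddr (col n) n (inr u) ->
    forall s, u = [:: true, false, false, false & s] \/ u = false :: s -> s = [::].
  by move=> hu [|a s] // [] e; move: hu; rewrite e /= ?addr_nograft.
have right_right u v : jaddr (col n) n (inr u) -> jaddr (col n) n (inr v) ->
    good (inr u) (inr v).
  move=> /tail_nil hu /tail_nil hv; rewrite /good.
  case: u hu => [|[] [|[] [|[] u]]] hu; try (case: u hu => [|[] u] hu);
  case: v hv => [|[] [|[] [|[] v]]] hv; try (case: v hv => [|[] v] hv);
  rewrite /= /same_edge ?coord_eqE /= ?andbF ?andbT ?orbF //;
  try by [case: (v)|rewrite ?(hu _ (or_introl erefl)) ?(hv _ (or_introl erefl))
         |rewrite ?(hu _ (or_intror erefl)) ?(hv _ (or_intror erefl))
         |have := hu _ (or_intror erefl)|have := hv _ (or_intror erefl)].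
rewrite -/(good j k); case: j k => [u|u] [v|v] hu hv; first last.
- exact: right_right.
- exact: (good_sym _ _ (left_right v u hu)).
- exact: (left_right u v hv).
case pu: (prefix (cut n) u); case pv: (prefix (cut n) v).
- case/prefixP: pu pv => s -> /prefixP[t ->].
  rewrite /good /= !prefix_prefix !drop_size_cat // wadj_cat /same_edge !coord_eqE /=.
  have ne s' : cut n ++ s' == w = false.
    apply/eqP => /(congr1 size); rewrite size_cat sw => /eqP.
    by rewrite gtn_eqF // addSn ltnS leq_addr.
  by rewrite !ne /= !andbF.
- exact: (mixed u v pu (negbT pv)).
- exact: (good_sym _ _ (mixed v u pv (negbT pu))).
- have ne s : prefix (cut n) s = false -> s == cut n = false.
    by apply: contraFF => /eqP ->; rewrite prefix_refl.
  rewrite /good /= pu pv /same_edge !coord_eqE /= (ne _ pu) (ne _ pv) /= andbF.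
  by [].
Qed.

Definition regraft_word (s : coord -> coord) n v := ofj n (s (toj n v)).

Lemma addr_regraft n v : addr tab (Root (col n)) v ->
  addr tab (Root (~~ col n)) (regraft_word (swap n) n v).
Proof. by move=> /(toj_domain n)[h _]; apply/addr_ofj/swap_jaddr. Qed.

Lemma addr_regraft_inv n v : addr tab (Root (~~ col n)) v ->
  addr tab (Root (col n)) (regraft_word (swap_inv n) n v).
Proof. by move=> /(toj_domain n)[h _]; apply/addr_ofj/swap_inv_jaddr. Qed.

Definition regraft n (x : tree (col n)) : tree (~~ col n) :=
  exist _ (regraft_word (swap n) n (val x)) (addr_regraft (valP x)).

Definition regraft_inv n (x : tree (~~ col n)) : tree (col n) :=
  exist _ (regraft_word (swap_inv n) n (val x)) (addr_regraft_inv (valP x)).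

Lemma regraft_bij n : bijective (@regraft n).
Proof.
exists (@regraft_inv n) => -[v hv]; apply: val_inj; rewrite /= /regraft_word;
  have [h e] := toj_domain n hv.
  by rewrite (ofjK (swap_jaddr h)) (swapK h).
by rewrite (ofjK (swap_inv_jaddr h)) (swap_invK h).
Qed.

Lemma eq_ofj c n v j : addr tab (Root c) v -> jaddr c n j -> (v == ofj n j) = (toj n v == j).
Proof.
move=> hv hj; have [h e] := toj_domain n hv.
by apply/eqP/eqP => [->|<-//]; rewrite (ofjK hj).
Qed.

Lemma level_pair n w b (x y : tree (col n)) : cut n = rcons w b ->
    val x = al n (cut n) -> val y = al n w ->
  exists (h : adj x y) (x' y' : tree (~~ col n)) (h' : adj x' y'),
  [/\ val x' = sp n ++ [:: true; false; false; false; false],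
      val y' = sp n ++ [:: true; false; false; false],
      isomorphic (del_vertex x) (del_vertex x') &
      isomorphic (del_edge (edge_of h)) (del_edge (edge_of h'))].
Proof.
move=> ecut ex ey.
have jcut : jaddr (col n) n (inl (cut n)) by rewrite /= /addr run_cut.
have jw : jaddr (col n) n (inl w) by move: jcut; rewrite /= ecut; apply: addr_rconsl.
have h : adj x y.
  by rewrite /= /tadj ex ey (wadj_al jcut jw) ecut wadj_sym wadj_rcons.
have jx' : jaddr (~~ col n) n (inr [:: true; false; false; false; false]).
  have := swap_jaddr jcut; by rewrite /swap prefix_refl drop_size.
have jy' : jaddr (~~ col n) n (inr [:: true; false; false; false]).
  exact: (@addr_rconsl _ _ [:: true; false; false; false] false jx').
pose x' : tree (~~ col n) := vertex_at (addr_ofj jx').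
pose y' : tree (~~ col n) := vertex_at (addr_ofj jy').
have h' : adj x' y' := etrans (wadj_ofj jx' jy') erefl.
have fx : regraft x = x'.
  apply: val_inj; rewrite /= /regraft_word ex -[al _ _]/(ofj n (inl (cut n))) (ofjK jcut).
  by rewrite /swap prefix_refl drop_size.
have fadj u v : adj u v && ~~ same_edge u v x y =
    adj (regraft u) (regraft v) && ~~ same_edge (regraft u) (regraft v) x' y'.
  have [hu eu] := toj_domain n (valP u); have [hv ev] := toj_domain n (valP v).
  have E1 (z : tree (col n)) j (hj : jaddr (col n) n j) (z' : tree (col n)) :
      val z' = ofj n j -> (z == z') = (toj n (val z) == j).
    by move=> ez; rewrite -val_eqE ez (eq_ofj (valP z) hj).
  have E2 (z : tree (col n)) j (hj : jaddr (~~ col n) n j) (z' : tree (~~ col n)) :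
      val z' = ofj n j -> (regraft z == z') = (swap n (toj n (val z)) == j).
    move=> ez; rewrite -val_eqE ez (eq_ofj (valP (regraft z)) hj) /= /regraft_word.
    by have [hz _] := toj_domain n (valP z); rewrite (ofjK (swap_jaddr hz)).
  have := jadj_swap ecut hu hv; rewrite /same_edge.
  rewrite -!(E1 _ _ jcut x) // -!(E1 _ _ jw y) // -!(E2 _ _ jx' x') // -!(E2 _ _ jy' y') //.
  rewrite -(wadj_ofj hu hv) eu ev -(wadj_ofj (swap_jaddr hu) (swap_jaddr hv)).
  by [].
exists h, x', y', h'; split=> //.
  exact: (regraft_vertex (regraft_bij n) fx fadj).
exact: (regraft_edge (regraft_bij n) h h' fadj).
Qed.

(** * Matching vertices and edges of one tree with those of the other *)

Lemma prefix_sp_size n v : size v <= n -> ~~ prefix (sp n) v.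
Proof.
by move=> le; apply/negP => /prefixP[s e]; move: le; rewrite e size_cat size_sp; lia.
Qed.

Lemma vertex_match c (x : tree c) : exists n (x' : tree (~~ c)),
  [/\ val x = al n (cut n), val x' = sp n ++ [:: true; false; false; false; false] &
      isomorphic (del_vertex x) (del_vertex x')].
Proof.
have [n [_ ec pn en]] := cut_target 0 (valP x); subst c.
have [hw ew] := be_domain (valP x) pn.
case/lastP ecut: (cut n) (cut_neq0 n) => [//|w b] _.
have hy : addr tab (Ar (col n) n) w by apply: (@addr_rconsl _ _ _ b); rewrite -ecut en.
have ex : val x = al n (cut n) by rewrite en ew.
have [h [x' [y' [h' [ex' _ i _]]]]] :=
  @level_pair n w b x (vertex_at (addr_al hy)) ecut ex erefl.
by exists n, x'.
Qed.

Lemma edge_match c (e : edges (tree c)) : exists n w b (x y : tree c) (x' y' : tree (~~ c)),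
  [/\ cut n = rcons w b, val x = al n (cut n) /\ val y = al n w,
      val x' = sp n ++ [:: true; false; false; false; false] /\
      val y' = sp n ++ [:: true; false; false; false],
      val e = [set x; y] &
  exists2 e' : edges (tree (~~ c)), val e' = [set x'; y'] &
      isomorphic (del_edge e) (del_edge e')].
Proof.
have [x [y [xy ee]]] := set_mem (valP e).
have [N lx ly] : exists2 N, size (val x) <= N & size (val y) <= N.
  by exists (size (val x) + size (val y)); rewrite ?leq_addr ?leq_addl.
(* From level [N] on, each further level prepends two letters to the address of either end. Thus the
   end farther from the cut can be fixed before the level at which it is the cut vertex is
   chosen. *)
have grow (z : tree c) : size (val z) <= N ->
    forall i, size (be (N + i) (val z)) = size (be N (val z)) + i.*2.
  move=> le; elim=> [|i IH]; first by rewrite !addn0.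
  rewrite addnS /= (negPf (prefix_sp_size _)) /= ?IH; last by rewrite (leq_trans le) ?leq_addr.
  by rewrite doubleS !addnS.
have wbe n : N <= n -> wadj (be n (val x)) (be n (val y)).
  move=> le.
  have [hx ex] := be_domain (valP x) (prefix_sp_size (leq_trans lx le)).
  have [hy ey] := be_domain (valP y) (prefix_sp_size (leq_trans ly le)).
  by rewrite -(wadj_al hx hy) ex ey.
wlog lt : x y xy ee lx ly wbe / size (be N (val y)) < size (be N (val x)).
  move=> W; case: (wadj_size (wbe N (leqnn N))) => es.
    apply: (W y x) => //; rewrite ?es //; [by rewrite adj_sym|by rewrite setUC|].
    by move=> n le; rewrite wadj_sym wbe.
  by apply: (W x y) => //; rewrite es.
have lt_from n : N <= n -> size (be n (val y)) < size (be n (val x)).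
  by move=> le; rewrite -(subnKC le) !grow // ltn_add2r.
have [n [le ec pn en]] := cut_target N (valP x); subst c.
have [b eb] : exists b, be n (val x) = rcons (be n (val y)) b.
  case/wadjP: (wbe n le) => // -[b eb].
  by have := lt_from n le; rewrite eb size_rcons ltnNge leqnSn.
have [hx ex] := be_domain (valP x) pn.
have [hy ey] := be_domain (valP y) (prefix_sp_size (leq_trans ly le)).
have ex2 : val x = al n (cut n) by rewrite en ex.
have ecut : cut n = rcons (be n (val y)) b by rewrite en.
have [h [x' [y' [h' [ex' ey' _ i]]]]] := level_pair ecut ex2 (esym ey).
exists n, (be n (val y)), b, x, y, x', y'; split=> //.
exists (edge_of h') => //.
have -> // : e = edge_of h by apply: val_inj.
Qed.

(** The length of the image word reveals the level, and the level determines the vertex through its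
    cut. *)
Lemma vertex_injection c : exists2 f : tree c -> tree (~~ c), injective f &
  forall x, isomorphic (del_vertex x) (del_vertex (f x)).
Proof.
have /choice[k /choice[f fP]] := @vertex_match c.
exists f => [x y e|x]; last by case: (fP x).
case: (fP x) (fP y) => [ex ex' _] [ey ey' _].
have ek : k x = k y.
  by have := congr1 size ex'; rewrite e ey' !size_cat !size_sp /=; lia.
by apply: val_inj; rewrite ex ey ek.
Qed.

Lemma edge_injection c : exists2 f : edges (tree c) -> edges (tree (~~ c)), injective f &
  forall e, isomorphic (del_edge e) (del_edge (f e)).
Proof.
have /choice[f fP] : forall e : edges (tree c), exists e' : edges (tree (~~ c)),
    isomorphic (del_edge e) (del_edge e') /\
    exists n w b (x y : tree c) (x' y' : tree (~~ c)),
    [/\ cut n = rcons w b, val x = al n (cut n) /\ val y = al n w,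
      val x' = sp n ++ [:: true; false; false; false; false] /\
      val y' = sp n ++ [:: true; false; false; false],
      val e = [set x; y] & val e' = [set x'; y']].
  move=> e; have [n [w [b [x [y [x' [y' [H1 H2 H3 H4 [e' H5 H6]]]]]]]]] := edge_match e.
  by exists e'; split=> //; exists n, w, b, x, y, x', y'.
exists f => [e1 e2 e|e]; last by case: (fP e).
have [_ [n [w [b [x [y [x' [y' [cn [ex ey] [ex' ey'] s1 t1]]]]]]]]] := fP e1.
have [_ [m [w2 [b2 [x2 [y2 [x2' [y2' [cm [ex2 ey2] [ex2' ey2'] s2 t2]]]]]]]]] := fP e2.
(* The two ends of an image edge have lengths of opposite parity, so equal edges match end by end,
   and the lengths give the level. *)
have nm : n = m.
  have /same_edgeP/orP[] : [set x'; y'] = [set x2'; y2'] by rewrite -t1 e t2.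
    move=> /andP[/eqP/(congr1 (size \o val)) /=].
    by rewrite ex' ex2' !size_cat !size_sp /=; lia.
  move=> /andP[/eqP/(congr1 (size \o val)) /=].
  by rewrite ex' ey2' !size_cat !size_sp /=; lia.
subst m; move: cm; rewrite cn => /rcons_inj[ew _].
have -> : e1 = e2 => //; apply: val_inj; rewrite s1 s2.
have -> : x = x2 by apply: val_inj; rewrite ex ex2.
by have -> : y = y2 by apply: val_inj; rewrite ey ey2 ew.
Qed.

Lemma trees_vertex_hypomorphic : vertex_hypomorphic (tree false) (tree true).
Proof.
have [f fi fP] := vertex_injection false; have [g gi gP] := vertex_injection true.
apply: (@cantor_bernstein_rel (tree false) (tree true)
  (fun x y => isomorphic (del_vertex x) (del_vertex y)) f g) => // y.
exact: isomorphic_sym.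
Qed.

Lemma trees_edge_hypomorphic : edge_hypomorphic (tree false) (tree true).
Proof.
have [f fi fP] := edge_injection false; have [g gi gP] := edge_injection true.
apply: (@cantor_bernstein_rel (edges (tree false)) (edges (tree true))
  (fun x y => isomorphic (del_edge x) (del_edge y)) f g) => // y.
exact: isomorphic_sym.
Qed.

(** * Local structure preserved by embeddings *)

Fixpoint strip (q : state) : state := if q is Pr _ q' then strip q' else q.

Lemma step_strip E q b p : step E q b = Some p -> exists p',
  [/\ step E (strip q) b = Some p', strip p' = strip p & forall u, addr E p u -> addr E p' u].
Proof.
elim: q p => [c|c|c n|c n|c n|c n|c n||n|n|w q IH] p /= e; try by exists p.
case: w e => [|a w]; first exact: IH.
case: ifP => _; last exact: IH.
case: eqP => // /eqP w0; case es: (step E q b) IH => [p1|] //= IH [<-].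
have [p' [e1 e2 e3]] := IH _ erefl; exists p'; split=> // u.
by rewrite addr_Pr // => /andP[/e3].
Qed.

(* The states only met on the way from the root of [tree c] to its level 0. *)
Definition low (q : state) : option bool :=
  match strip q with
  | Root c | Base c | Up c 0 | Sp c 0 => Some c
  | _ => None
  end.

Lemma low_step E q b p : (forall m e, E m = Some e -> low e.2 = None) ->
  step E q b = Some p -> low p = low q \/ low p = None.
Proof.
move=> lowE /step_strip[p' [e ep _]].
have <- : low p' = low p by rewrite /low ep.
rewrite [low q]/low.
have : forall w q', strip q <> Pr w q' by elim: (q).
case: (strip q) e => [c|c|c n|c n|c n|c n|c n||n|n|w q'] /=; last by move=> _ /(_ w q').
- by case: b => // -[<-]; left.
- by case: b => -[<-]; [left|right].
- by case: b => -[<-]; [left|right].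
- by case: b => -[<-]; right.
- by case: b; [|case: ifP => _] => -[<-]; right.
- by case: b => -[<-]; right.
- by case: n => [|n]; [|case: b] => -[<-]; right.
- by [].
- by case: b => [|[<-] _]; [case: (E n) => // e [<-]|]; right.
- by case: b => //; case en: (E n) => [e|//] [<-]; right; apply: lowE en.
Qed.

Lemma low_run E q u p : (forall m e, E m = Some e -> low e.2 = None) ->
  run E q u = Some p -> low p = low q \/ low p = None.
Proof.
move=> lowE; elim: u q => [|b u IH] q /=; first by case=> ->; left.
case e: (step E q b) => [q'|] //= /IH[->|->]; last by right.
exact: low_step lowE e.
Qed.

Lemma low_entry n E : (forall m e, E m = Some e -> low e.2 = None) ->
  low (entry n E).2 = None.
Proof.
move=> lowE; rewrite /entry; case: ifP => _ /=; last by case: n.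
by case e: (run _ _ _) => [p|] //=; case: (low_run lowE e) => ->; case: (n).
Qed.

Lemma low_stem n : low (stem n) = None.
Proof.
rewrite /stem; apply: low_entry; elim: n => // n IH m e /=.
by case: eqP => [_ [<-]|_]; [apply: low_entry|apply: IH].
Qed.

(** No transition and no stem leads back to the start of a spine. In particular the tree of the
    other colour has no vertex of kind [Sp c 0]. *)
Lemma low_root c u p : run tab (Root c) u = Some p -> low p = Some c \/ low p = None.
Proof. by apply: low_run => m e [<-]; apply: low_stem. Qed.

(** * Kinds and degrees of vertices *)

Definition state_at c (x : tree c) : state := odflt Lf (run tab (Root c) (val x)).

Lemma run_state_at c (x : tree c) : run tab (Root c) (val x) = Some (state_at x).
Proof. by move: (valP x); rewrite /state_at /addr; case: run. Qed.

Definition kind c (x : tree c) : state := strip (state_at x).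

Lemma kind_child c (x y : tree c) b : val y = rcons (val x) b ->
  omap strip (step tab (kind x) b) = Some (kind y).
Proof.
move=> e; have := run_state_at y; rewrite e run_rcons run_state_at /= => /step_strip.
by case=> p' [-> /= -> _].
Qed.

Lemma kind_Pr c (x : tree c) w q : kind x <> Pr w q.
Proof. by rewrite /kind; elim: (state_at x). Qed.

Lemma adjP c (x y : tree c) : adj x y ->
  (exists b, val y = rcons (val x) b) \/ (exists b, val x = rcons (val y) b).
Proof. by move/wadjP. Qed.

Section Degrees.
Variable G : sgraph.

(** Lower bounds witnessed by lists survive embeddings that are not induced. In the two trees
    degrees are at most 3, so three witnesses are all the neighbours. *)
Definition deg_ge k (x : G) := exists s : seq G, [/\ size s = k, uniq s & all (adj x) s].

Definition nbrs3 (P : G -> Prop) (x : G) :=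
  exists s : seq G, [/\ size s = 3, uniq s, all (adj x) s & forall y, y \in s -> P y].

End Degrees.

Definition full (G : sgraph) (x : G) := nbrs3 (deg_ge 3) x.
Definition decorated (G : sgraph) (x : G) := nbrs3 (deg_ge 2) x.

Lemma nbrs3_deg (G : sgraph) P (x : G) : nbrs3 P x -> deg_ge 3 x.
Proof. by case=> s [s1 s2 s3 _]; exists s. Qed.

Section Embedding.
Variables (G H : sgraph) (f : G -> H).
Hypotheses (finj : injective f) (fhom : {homo f : x y / adj x y}).

Lemma deg_ge_hom k x : deg_ge k x -> deg_ge k (f x).
Proof.
case=> s [s1 s2 s3]; exists (map f s); rewrite size_map map_inj_uniq //; split=> //.
by apply/allP => _ /mapP[y ys ->]; apply/fhom/(allP s3).
Qed.

Lemma nbrs3_hom k x : nbrs3 (deg_ge k) x -> nbrs3 (deg_ge k) (f x).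
Proof.
case=> s [s1 s2 s3 s4]; exists (map f s); rewrite size_map map_inj_uniq //; split=> //.
  by apply/allP => _ /mapP[y ys ->]; apply/fhom/(allP s3).
by move=> _ /mapP[y ys ->]; apply/deg_ge_hom/s4.
Qed.

End Embedding.

Section TreeDegrees.
Variable c : bool.
Implicit Types x y z : tree c.

(* A superset of the addresses of the neighbours. *)
Definition nbw (u : word) : seq word :=
  (if u is a :: u' then [:: belast a u'] else [::]) ++ [:: rcons u false; rcons u true].

Lemma belast_rcons_behead (v : word) b :
  exists a u', rcons v b = a :: u' /\ belast a u' = v.
Proof. by case: v => [|a v]; [exists b, [::]|exists a, (rcons v b); rewrite belast_rcons]. Qed.

Lemma adj_nbw x y : adj x y -> val y \in nbw (val x).
Proof.
case/adjP => -[b e]; first by rewrite e mem_cat !inE; case: b {e}; rewrite eqxx !orbT.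
by have [a [u' [e1 e2]]] := belast_rcons_behead (val y) b; rewrite e e1 /= inE e2 eqxx.
Qed.

Lemma deg3_nbw x (s : seq (tree c)) : size s = 3 -> uniq s -> all (adj x) s ->
  size (nbw (val x)) = 3 /\ map val s =i nbw (val x).
Proof.
move=> s1 s2 s3.
have sub : {subset map val s <= nbw (val x)}.
  by move=> _ /mapP[y ys ->]; apply/adj_nbw/(allP s3).
have un : uniq (map val s) by rewrite map_inj_uniq //; apply: val_inj.
have le : size (nbw (val x)) <= 3 by case: (val x).
have := uniq_leq_size un sub; rewrite size_map s1 => ge.
have e3 : size (nbw (val x)) = 3 by apply/eqP; rewrite eqn_leq le.
split=> //; have [] := uniq_min_size un sub => //; by rewrite size_map s1.
Qed.

Lemma deg3P x : deg_ge 3 x -> exists (p l r : tree c) (b : bool),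
  [/\ val x = rcons (val p) b, val l = rcons (val x) false & val r = rcons (val x) true].
Proof.
case=> s [s1 s2 s3]; have [e3 es] := deg3_nbw s1 s2 s3.
have /mapP[l _ el] : rcons (val x) false \in map val s.
  by rewrite es mem_cat !inE eqxx orbT.
have /mapP[r _ er] : rcons (val x) true \in map val s.
  by rewrite es mem_cat !inE eqxx !orbT.
case/lastP ex: (val x) e3 es el er => [//|v b] e3 es el er.
have [a [u' [e1 e2]]] := belast_rcons_behead v b.
have /mapP[p _ ep] : v \in map val s by rewrite es e1 /= inE e2 eqxx.
by exists p, l, r, b; rewrite -ep -el -er.
Qed.

Lemma nbrs3_all P x y : nbrs3 P x -> adj x y -> P y.
Proof.
case=> s [s1 s2 s3 s4] xy; have [_ es] := deg3_nbw s1 s2 s3.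
have /mapP[z zs ez] : val y \in map val s by rewrite es adj_nbw.
by have -> : y = z; [apply: val_inj|apply: s4].
Qed.

Definition two (q : state) := isSome (step tab q false) && isSome (step tab q true).

Lemma deg3_two x : deg_ge 3 x -> two (kind x).
Proof.
move=> /deg3P[p [l [r [b [_ el er]]]]]; rewrite /two.
by have := kind_child el; have := kind_child er; do 2 case: (step _ _ _).
Qed.

(** Hubs, as opposed to the links of [isX]. The left child of a link is a leaf or a stalk, of degree
    at most 2, so a full vertex can only be a hub. *)
Definition isH q := match q with Base _ | Sp _ _ | Rg _ _ | Ar _ _ => true | _ => false end.
Definition isX q := match q with Up _ _ | Dn _ _ | Gr _ => true | _ => false end.

Lemma deg3_HX x : deg_ge 3 x -> ~~ isH (kind x) -> isX (kind x).
Proof.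
move/deg3_two; have := @kind_Pr _ x; case: (kind x) => // w q /(_ w q) //.
Qed.

Lemma X_children x y b : isX (kind x) -> val y = rcons (val x) b ->
  if b then isH (kind y) : Prop else (kind y = Lf \/ exists n, kind y = St n).
Proof.
move=> hx /kind_child; case: (kind x) hx => //= [a n|a n|n] _; case: b => //= -[<-] //;
  by [left|right; exists n].
Qed.

Lemma adj_child x y b : val y = rcons (val x) b -> adj x y.
Proof. by move=> e; rewrite /= /tadj e wadj_rcons. Qed.

Lemma full_H x : full x -> isH (kind x).
Proof.
move=> fx; have d3 := nbrs3_deg fx; apply: contraT => /(deg3_HX d3) hX.
have [p [l [r [b [_ el _]]]]] := deg3P d3.
have := deg3_two (nbrs3_all fx (adj_child el)).
by case: (X_children hX el) => [->|[n ->]].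
Qed.

Lemma H_child x y b : isH (kind x) -> isH (kind y) -> val y = rcons (val x) b ->
  b = false /\ exists a n, kind y = Rg a n /\ (kind x = Sp a n \/ kind x = Ar a n.+1).
Proof.
move=> hx hy /kind_child; move: hy; case: (kind x) hx => //= [a|a n|a n|a n] _.
- by case: b => hy [ey]; rewrite -ey in hy.
- case: b => hy [ey]; rewrite -ey in hy * => //; split=> //; exists a, n; by split=> //; left.
- by case: b => hy; [|case: ifP => _] => -[ey]; rewrite -ey in hy.
- case: n => [|n]; first by move=> hy [ey]; rewrite -ey in hy.
  case: b => hy [ey]; rewrite -ey in hy * => //; split=> //; exists a, n; by split=> //; right.
Qed.

Lemma parent_uniq x y z b d : val x = rcons (val y) b -> val x = rcons (val z) d -> y = z.
Proof. by move=> -> /rcons_inj[e _]; apply: val_inj. Qed.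

(** Two adjacent hubs are a rung and its parent, an [Sp] or an [Ar], so adjacency among hubs is a
    partial matching. *)
Lemma H_nbr_uniq x y z : isH (kind x) -> adj x y -> adj x z ->
  isH (kind y) -> isH (kind z) -> y = z.
Proof.
move=> hx xy xz hy hz; case: (adjP xy) => -[b eb]; case: (adjP xz) => -[d ed].
- have [b0 _] := H_child hx hy eb; have [d0 _] := H_child hx hz ed.
  by apply: val_inj; rewrite eb ed b0 d0.
- have [_ [a [n [_ k1]]]] := H_child hx hy eb; have [_ [a' [n' [k2 _]]]] := H_child hz hx ed.
  by move: k1; rewrite k2 => -[].
- have [_ [a [n [k1 _]]]] := H_child hy hx eb; have [_ [a' [n' [_ k2]]]] := H_child hx hz ed.
  by move: k2; rewrite k1 => -[].
- exact: parent_uniq eb ed.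
Qed.

Lemma Lf_deg2 x : deg_ge 2 x -> kind x <> Lf.
Proof.
case=> s [s1 s2 s3] kx; case: s s1 s2 s3 => [|y [|z [|//]]] // _.
rewrite /= inE andbT => yz /and3P[xy xz _].
have par t : adj x t -> exists b, val x = rcons (val t) b.
  by case/adjP => // -[b /kind_child]; rewrite kx.
have [b eb] := par _ xy; have [d ed] := par _ xz.
by move: yz; rewrite (parent_uniq eb ed) eqxx.
Qed.

Lemma decorated_Gr x : isX (kind x) -> decorated x -> exists n, kind x = Gr n.
Proof.
move=> hX dx; have [p [l [r [b [_ el _]]]]] := deg3P (nbrs3_deg dx).
have := Lf_deg2 (nbrs3_all dx (adj_child el)).
have := kind_child el; case: (kind x) hX => //= [a n|a n|n] _; try by case=> <-.
by exists n.
Qed.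

End TreeDegrees.

(** * Rays *)

Definition ray (G : sgraph) (h x : nat -> G) := forall i,
  [/\ adj (h i) (x i), adj (x i) (h i.+1), h i != h i.+1, x i != x i.+1 & full (h i)].

Lemma ray_hom (G H : sgraph) (f : G -> H) h x : injective f ->
  {homo f : x y / adj x y} -> ray h x -> ray (f \o h) (f \o x).
Proof.
move=> finj fhom r i; have [h1 h2 h3 h4 h5] := r i.
by split; rewrite /= ?(inj_eq finj) ?fhom //; apply: nbrs3_hom.
Qed.

Section Rays.
Variable c : bool.
Variables h x : nat -> tree c.
Hypothesis rhx : ray h x.

Definition descends i := exists b, val (x i) = rcons (val (h i)) b.

Lemma ray_H i : isH (kind (h i)).
Proof. by apply: full_H; have [] := rhx i. Qed.

(** A hub [x i] would have the two distinct hubs [h i] and [h i.+1] as neighbours. *)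
Lemma ray_nH i : ~~ isH (kind (x i)).
Proof.
have [h1 h2 h3 _ _] := rhx i; apply/negP => hH.
have e : h i = h i.+1 by apply: (H_nbr_uniq hH) => //; rewrite 1?adj_sym //; apply: ray_H.
by rewrite e eqxx in h3.
Qed.

Lemma ray_X i : isX (kind (x i)).
Proof.
have [h1 _ _ _ hf] := rhx i; apply: deg3_HX (ray_nH i); exact: nbrs3_all hf h1.
Qed.

Lemma X_child_H (y z : tree c) b : isX (kind y) -> isH (kind z) ->
  val z = rcons (val y) b -> b = true.
Proof.
move=> hX hH /(X_children hX); case: b => //.
by move=> [e|[n e]]; rewrite e in hH.
Qed.

Lemma descends_next i : descends i ->
  val (h i.+1) = rcons (val (x i)) true /\ descends i.+1.
Proof.
move=> [b eb]; have [_ h2 h3 h4 _] := rhx i; have [h5 _ _ _ _] := rhx i.+1.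
have e : val (h i.+1) = rcons (val (x i)) true.
  case/adjP: h2 => -[d ed]; first by rewrite -(X_child_H (ray_X i) (ray_H i.+1) ed).
  by rewrite (parent_uniq eb ed) eqxx in h3.
split=> //; case/adjP: h5 => // -[d ed].
by rewrite (parent_uniq e ed) eqxx in h4.
Qed.

Lemma descendsW i j : i <= j -> descends i -> descends j.
Proof.
move/subnKC <-; elim: (j - i) => [|k IH] hi; rewrite ?addn0 // addnS.
exact: (descends_next (IH hi)).2.
Qed.

(** A hub can only be the right child of a link, so the ray cannot enter and leave the link [x i]
    through two children. *)
Lemma not_descends i : ~ descends i -> exists b d,
  val (h i) = rcons (val (x i)) b /\ val (x i) = rcons (val (h i.+1)) d.
Proof.
move=> nd; have [h1 h2 h3 _ _] := rhx i.
case/adjP: h1 => -[b eb]; first by case: nd; exists b.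
case/adjP: h2 => -[d ed]; last by exists b, d.
have e1 := X_child_H (ray_X i) (ray_H i) eb; have e2 := X_child_H (ray_X i) (ray_H i.+1) ed.
have e : h i = h i.+1 by apply: val_inj; rewrite eb ed e1 e2.
by rewrite e eqxx in h3.
Qed.

(** As long as the ray climbs, its words get shorter. *)
Lemma ray_turns : exists2 k, descends k & forall i, i < k -> ~ descends i.
Proof.
have ex : exists k, `[< descends k >].
  apply: contrapT => nd.
  have lt i : size (val (h i)) + i <= size (val (h 0)).
    elim: i => [|i IH]; first by rewrite addn0.
    have [|b [d [e1 e2]]] := @not_descends i.
      by move=> di; apply: nd; exists i; apply/asboolP.
    by move: IH; rewrite e1 e2 !size_rcons; lia.
  by have := lt (size (val (h 0))).+1; lia.
case: (ex_minnP ex) => k /asboolP dk mk; exists k => // i lt /asboolP /mk.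
by rewrite leqNgt lt.
Qed.

(* A ray cannot descend along links of [Ar]: their levels decrease. *)
Lemma ray_not_Ar i a m : descends i -> kind (h i.+1) <> Ar a m.
Proof.
elim: m i => [|m IH] i di ka; have [e [b eb]] := descends_next di;
  have [_ _ _ _ hf] := rhx i.+1.
  have [p [l [r [d [_ el _]]]]] := deg3P (nbrs3_deg hf).
  have := deg3_two (nbrs3_all hf (adj_child el)).
  by have := kind_child el; rewrite ka => -[<-].
have := kind_child eb; rewrite ka /=; case: b eb => eb [kx]; last first.
  by have := ray_nH i.+1; rewrite -kx.
have [|e2 _] := @descends_next i.+1; first by exists true.
have := kind_child e2; rewrite -kx => -[kh].
exact: (IH i.+1 (descends_next di).2 (esym kh)).
Qed.

(** By [ray_not_Ar] the link [x i] is neither a [Dn] nor a [Gr]. From an [Up] on, the ray must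
    follow the spine, because the left child of an [Sp] is a hub. *)
Lemma ray_Up i : descends i -> exists a m, forall j,
  kind (x (i + j)) = Up a (m + j) /\ kind (h (i + j).+1) = Sp a (m + j).
Proof.
move=> di; have [e _] := descends_next di; have := kind_child e; have := ray_X i.
have nAr a m := @ray_not_Ar i a m di.
case kx: (kind (x i)) => [||a m|||a m|||m||] // _ [kh];
  [|by case: (nAr a m)|by case: (nAr (col m) m)].
exists a, m; elim=> [|j [IH1 IH2]]; first by rewrite !addn0.
have dj : descends (i + j) by apply: descendsW di; rewrite leq_addr.
have [_ [b eb]] := descends_next dj; rewrite !addnS.
have kxj : kind (x (i + j).+1) = Up a (m + j).+1.
  have := kind_child eb; rewrite IH2; case: b eb => eb [kx'] //.
  by have := ray_nH (i + j).+1; rewrite -kx'.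
split=> //; have [e2 _] := descends_next (descendsW (leqnSn _) dj).
by have := kind_child e2; rewrite kxj => -[].
Qed.

End Rays.

(** * Full vertices and rays in the source tree *)

Section Source.
Variable c : bool.

Lemma nbrs3I P (x : tree c) v b :
    val x = rcons v b -> two (state_at x) ->
    (forall y, adj x y -> P y) -> nbrs3 P x.
Proof.
move=> ev t HP; have hx := run_state_at x.
have h0 : addr tab (Root c) (rcons (val x) false).
  by rewrite /addr run_rcons hx /=; case/andP: t.
have h1 : addr tab (Root c) (rcons (val x) true).
  by rewrite /addr run_rcons hx /=; case/andP: t.
have hv : addr tab (Root c) v by apply: (@addr_rconsl _ _ _ b); rewrite -ev (valP x).
pose y0 := vertex_at h0; pose y1 := vertex_at h1; pose y := vertex_at hv.
have a0 : adj x y0 by apply: (adj_child (b := false)).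
have a1 : adj x y1 by apply: (adj_child (b := true)).
have a : adj x y by rewrite adj_sym; apply: (adj_child (b := b)).
exists [:: y; y0; y1]; split=> //=.
- have ne (s r : tree c) : size (val s) <> size (val r) -> s != r.
    by move=> es; apply/eqP => e; apply: es; rewrite e.
  have n01 : y0 != y1 by apply/eqP => /(congr1 val) /= /rcons_inj[].
  have n0 : y != y0 by apply: ne; rewrite /= ev !size_rcons => /eqP; rewrite ltn_eqF.
  have n1 : y != y1 by apply: ne; rewrite /= ev !size_rcons => /eqP; rewrite ltn_eqF.
  by rewrite !inE negb_or n0 n1 n01.
- by apply/and4P.
by move=> z; rewrite !inE => /or3P[] /eqP ->; apply: HP.
Qed.

Lemma deg3I (x : tree c) v b : val x = rcons v b -> two (state_at x) -> deg_ge 3 x.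
Proof. by move=> e t; apply: (@nbrs3_deg _ (fun=> True)); apply: nbrs3I e t _. Qed.

Lemma deg2I (x : tree c) v b d : val x = rcons v b -> addr tab (Root c) (rcons (val x) d) ->
  deg_ge 2 x.
Proof.
move=> e hd; have hv : addr tab (Root c) v by apply: (@addr_rconsl _ _ _ b); rewrite -e (valP x).
have av : adj x (vertex_at hv) by rewrite adj_sym; apply: (adj_child (b := b)).
have ad : adj x (vertex_at hd) by apply: (adj_child (b := d)).
exists [:: vertex_at hv; vertex_at hd]; split=> //=; last by apply/and3P.
rewrite inE andbT; apply/eqP => /(congr1 (size \o val)) /=.
by rewrite e !size_rcons => /eqP; rewrite ltn_eqF.
Qed.

Lemma state_atE (x : tree c) u q : val x = u -> run tab (Root c) u = Some q -> state_at x = q.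
Proof. by move=> <-; rewrite run_state_at => -[]. Qed.

Lemma fullI (x : tree c) v d b q q' : val x = rcons (rcons v d) b ->
    run tab (Root c) (rcons v d) = Some q -> step tab q b = Some q' -> two q -> two q' ->
    (forall e p, step tab q' e = Some p -> two p) ->
  full x.
Proof.
move=> ex rq sq tq tq' tc.
have hx : state_at x = q' by apply: (state_atE ex); rewrite run_rcons rq.
apply: (nbrs3I ex) => [|y]; first by rewrite hx.
case/adjP => -[e ey].
  apply: (deg3I ey); have := run_state_at y; rewrite ey run_rcons run_state_at hx /=.
  exact: tc.
have ey' : val y = rcons v d by move: ey; rewrite ex => /rcons_inj[].
by apply: (deg3I ey'); rewrite (state_atE ey' rq).
Qed.

Lemma full_Sp (x : tree c) v d a n : val x = rcons (rcons v d) true ->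
  run tab (Root c) (rcons v d) = Some (Up a n) -> full x.
Proof. by move=> ex rv; apply: (fullI ex rv) => // -[] p [<-]. Qed.

Lemma full_Rg (x : tree c) v d a n : val x = rcons (rcons v d) false ->
  run tab (Root c) (rcons v d) = Some (Sp a n) -> full x.
Proof.
move=> ex rv; apply: (fullI ex rv) => //.
by case=> p /=; last case: ifP => _; case=> <-.
Qed.

Lemma source_ray (hw : nat -> word) a m :
    (forall i, hw i.+1 = rcons (rcons (hw i) true) true) ->
    run tab (Root c) (rcons (hw 0) true) = Some (Up a m) ->
    (forall y : tree c, val y = hw 0 -> full y) ->
  exists h x : nat -> tree c, ray h x /\
    forall i, val (h i) = hw i /\ val (x i) = rcons (hw i) true.
Proof.
move=> hS r0 f0.
have rx i : run tab (Root c) (rcons (hw i) true) = Some (Up a (m + i)).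
  elim: i => [|i IH]; first by rewrite addn0.
  by rewrite hS !(run_rcons _ _ (rcons _ _)) IH /= addnS.
have ax i : addr tab (Root c) (rcons (hw i) true) by rewrite /addr rx.
exists (fun i => vertex_at (addr_rconsl (ax i))), (fun i => vertex_at (ax i)); split=> // i.
split.
- by rewrite /= /tadj /= wadj_rcons.
- by rewrite /= /tadj /= hS wadj_rcons.
- by apply/eqP => /(congr1 (size \o val)); rewrite /= hS !size_rcons => /eqP; rewrite ltn_eqF.
- by apply/eqP => /(congr1 (size \o val)); rewrite /= hS !size_rcons => /eqP; rewrite ltn_eqF.
case: i => [|i]; first exact: f0.
by apply: (@full_Sp _ (hw i) true a (m + i)); [exact: hS|exact: rx].
Qed.

Lemma decorated_rung (x : tree c) u a n : val x = rcons (rcons u false) false ->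
    run tab (Root c) u = Some (Sp a n) -> col n = ~~ a -> decorated x.
Proof.
move=> ex ru cn.
have rx : run tab (Root c) (val x) = Some (Gr n) by rewrite ex !run_rcons ru /= cn eqxx.
have sx := state_atE erefl rx.
apply: (nbrs3I ex) => [|y]; first by rewrite sx.
case/adjP => -[e ey]; last first.
  have ey' : val y = rcons u false by move: ey; rewrite ex => /rcons_inj[].
  by apply: (deg2I (d := true) ey'); rewrite ey' /addr !run_rcons ru.
case: e ey => ey; last first.
  by apply: (deg2I (d := false) ey); rewrite ey /addr !(run_rcons _ _ (rcons _ _)) run_rcons rx.
(* [d] leads to a child of the root of [Ar] that survives the pruning, even if the cut is at one of
   the two children. *)
pose d := if cut n is [:: b] then ~~ b else true.
apply: (deg2I (d := d) ey); rewrite ey -!cats1 /addr -catA run_cat rx /=.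
rewrite /d; case: (cut n) (cut_neq0 n) => [//|b [|b' w]] _ /=.
  by case: b => /=; case: (n).
by case: b => /=; case: (n).
Qed.

End Source.

(** * Non-embeddability *)

Lemma spS_rcons n : sp n.+1 = rcons (rcons (sp n) true) true.
Proof. by rewrite spS -!cats1 -catA. Qed.

Lemma run_Sp c n : run tab (Root c) (rcons (sp n) true) = Some (Sp c n).
Proof. by rewrite -cats1 run_sp. Qed.

Lemma run_Rg c n : run tab (Root c) (rcons (rcons (sp n) true) false) = Some (Rg c n).
Proof. by rewrite run_rcons run_Sp. Qed.

Lemma sp_rcons n : exists v, sp n = rcons v true.
Proof. by case: n => [|n]; [exists [:: true]|rewrite spS_rcons; eexists]. Qed.

Lemma al_nil_lt n : size (al n [::]) < size (sp n).
Proof. by rewrite size_sp; case: n => // n; cbn [al]; rewrite size_cat size_sp /= addn1. Qed.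

Lemma addr_run q u p : run tab q u = Some p -> addr tab q u.
Proof. by rewrite /addr => ->. Qed.

Section NoEmbedding.
Variable c : bool.
Variable f : tree c -> tree (~~ c).
Hypotheses (finj : injective f) (fhom : {homo f : x y / adj x y}).

Let image (u : word) : word := if insub u is Some x then val (f (x : tree c)) else [::].

Lemma image_val (x : tree c) : image (val x) = val (f x).
Proof. by rewrite /image valK. Qed.

(* Non-backtracking keeps the image of a rooted subtree below the image of its root;
   as the spheres of the subtree are finite, none of its vertices can be missing. *)
Lemma no_pruned_image n (x0 g : tree c) : c = col n ->
    val x0 = al n [::] -> val g = sp n -> val (f x0) = rcons (val (f g)) true ->
    kind (f g) = Gr n -> False.
Proof.
move=> cn ex0 eg efx kg.
have at_al u : addr tab (Ar c n) u -> exists x : tree c, val x = al n u.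
  by move=> hu; exists (vertex_at (addr_al hu)).
have below u : addr tab (Ar c n) u -> exists u',
    [/\ image (al n u) = val (f x0) ++ u', size u' = size u &
     forall v b, u = rcons v b -> exists b', image (al n u) = rcons (image (al n v)) b'].
  elim/last_ind: u => [|u b IH] hub.
    exists [::]; split=> // [|v b]; first by rewrite -ex0 image_val cats0.
    by move/(congr1 size); rewrite size_rcons.
  have hu := addr_rconsl hub; have [u' [e1 s1 p1]] := IH hu.
  have [x ex] := at_al _ hu; have [y ey] := at_al _ hub.
  have xy : adj x y by rewrite /= /tadj ex ey (wadj_al hu hub) wadj_rcons.
  move: e1 p1; rewrite -ex -ey !image_val => e1 p1.
  case/adjP: (fhom xy) => -[d ed].
    exists (rcons u' d); rewrite ed e1 rcons_cat !size_rcons s1; split=> // v b'.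
    by move/rcons_inj=> [<- _]; exists d; rewrite -ex image_val e1 rcons_cat.
  (* The image cannot step up: the parent there is already the image of [g], if [u] is empty, or of
     the predecessor of [u]. *)
  case/lastP: u hu hub IH s1 p1 ex ey => [|v a] hu hub IH s1 p1 ex ey.
    move: ed; rewrite e1 (size0nil s1) cats0 efx => /rcons_inj[/val_inj/finj e _].
    by have := al_prefix hub; rewrite -ey -e eg prefix_refl.
  have [z ez] := at_al _ (addr_rconsl hu).
  have [b' eb'] := p1 _ _ erefl; move: eb'; rewrite ed -ez image_val.
  move=> /rcons_inj[/val_inj/finj e _].
  have := congr1 (be n) ez; rewrite -e ey (be_al hub) (be_al (addr_rconsl hu)).
  by move/(congr1 size); rewrite !size_rcons => /eqP; rewrite gtn_eqF.
have target_addr u' : addr tab (Root (~~ c)) (val (f x0) ++ u') ->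
    addr tab (Ar c n) u' /\ ~~ prefix (cut n) u'.
  rewrite /addr run_cat; have := run_state_at (f x0); rewrite efx run_rcons run_state_at.
  rewrite [obind _ _]/= => sg; rewrite sg [obind _ _]/= => h.
  have [p' [e _ sub]] := step_strip sg; move: (sub _ h).
  rewrite -/(kind (f g)) kg /= in e; case: e => <-.
  by rewrite addr_Pr ?cut_neq0 // -cn => /andP[].
(* The radius is chosen such that the sphere [A] contains the cut vertex, which [phi] has to
   miss. *)
pose d := size (cut n).
pose A := [set u : d.-tuple bool | addr tab (Ar c n) u]%SET.
pose cutd : d.-tuple bool := in_tuple (cut n).
pose phi (u : d.-tuple bool) : d.-tuple bool :=
  insubd u (drop (size (val (f x0))) (image (al n u))).
have phiE u : u \in A -> image (al n u) = val (f x0) ++ phi u.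
  rewrite inE => hu; have [u' [e1 s1 _]] := below _ hu.
  by rewrite /phi e1 drop_size_cat // val_insubd s1 size_tuple eqxx.
have phi_sub : phi @: A \subset A :\ cutd.
  apply/fintype.subsetP => _ /imsetP[u uA ->].
  have hu : addr tab (Ar c n) u by rewrite inE in uA.
  have [x ex] := at_al _ hu.
  have := valP (f x); rewrite -image_val ex phiE // => /target_addr[h1 h2].
  rewrite !inE h1 andbT; apply: contra h2 => /eqP ->; exact: prefix_refl.
have phi_inj : {in A &, injective phi}.
  move=> u v uA vA e; have := phiE u uA; rewrite e -phiE //.
  have hu : addr tab (Ar c n) u by rewrite inE in uA.
  have hv : addr tab (Ar c n) v by rewrite inE in vA.
  have [x ex] := at_al _ hu; have [y ey] := at_al _ hv.
  rewrite -ex -ey !image_val => /val_inj/finj exy.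
  by apply: val_inj; rewrite /= -(be_al hu) -(be_al hv) -ex -ey exy.
have cA : cutd \in A by rewrite inE /= /addr cn run_cut.
have := subset_leq_card phi_sub; rewrite card_in_imset //.
by rewrite (cardsD1 cutd A) cA ltnn.
Qed.

Let t n : tree c := vertex_at (addr_run (run_Sp c n)).
Let r n : tree c := vertex_at (addr_run (run_Rg c n)).

Lemma full_t n : full (t n).
Proof.
have [v ev] := sp_rcons n; apply: (@full_Sp _ _ v true c n); first by rewrite -ev.
by rewrite -ev -[sp n]cats0 run_sp.
Qed.

Lemma full_r n : full (r n).
Proof. exact: (@full_Rg _ (r n) (sp n) true c n erefl (run_Sp c n)). Qed.

Lemma adj_tr n : adj (f (t n)) (f (r n)).
Proof. by apply: fhom; apply: (adj_child (b := false)). Qed.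

Lemma H_t n : isH (kind (f (t n))).
Proof. exact/full_H/nbrs3_hom/full_t. Qed.

Lemma H_r n : isH (kind (f (r n))).
Proof. exact/full_H/nbrs3_hom/full_r. Qed.

(** The graft link below the rung is decorated. Its image is no hub, since the one hub next to
    [f (r n)] is [f (t n)]; so it is a decorated link, which must be a [Gr]. *)
Lemma graft_next_to_rung n : col n = ~~ c -> exists (y : tree c) m,
  [/\ val y = rcons (val (r n)) false, adj (f (r n)) (f y), kind (f y) = Gr m & f y != f (t n)].
Proof.
move=> cn.
have hg : addr tab (Root c) (rcons (rcons (rcons (sp n) true) false) false).
  by rewrite /addr run_rcons run_Rg.
have rg : adj (r n) (vertex_at hg) by apply: (adj_child (b := false)).
have dg : decorated (vertex_at hg).
  exact: (@decorated_rung _ (vertex_at hg) (rcons (sp n) true) c n erefl (run_Sp c n) cn).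
have ng : f (vertex_at hg) != f (t n).
  rewrite (inj_eq finj); apply/eqP => /(congr1 (size \o val)).
  by rewrite /= !size_rcons => /eqP; rewrite gtn_eqF.
have d3 := nbrs3_all (nbrs3_hom finj fhom (full_r n)) (fhom rg).
have nH : ~~ isH (kind (f (vertex_at hg))).
  apply/negP => hH; case/eqP: ng; apply: (H_nbr_uniq (H_r n)) => //; last exact: H_t.
    exact: fhom.
  by rewrite adj_sym adj_tr.
have [m km] := decorated_Gr (deg3_HX d3 nH) (nbrs3_hom finj fhom dg).
by exists (vertex_at hg), m; split=> //; apply: fhom.
Qed.

Lemma no_embedding : False.
Proof.
have [h [x [rhx hxE]]] : exists h x : nat -> tree c, ray h x /\
    forall i, val (h i) = rcons (sp i) true /\ val (x i) = rcons (rcons (sp i) true) true.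
  apply: (@source_ray c (fun i => rcons (sp i) true) c 1) => [i||y ey].
  - by rewrite spS_rcons.
  - by rewrite run_rcons run_Sp.
  - by have -> : y = t 0; [apply: val_inj|apply: full_t].
have ht i : h i = t i by apply: val_inj; rewrite (hxE i).1.
have xs i : x i = spv c i.+1 by apply: val_inj; rewrite (hxE i).2 /= spS_rcons.
pose H i := f (h i); pose X i := f (x i).
have rHX : ray H X by apply: ray_hom.
have [k dk mk] := ray_turns rHX.
have [a [m up]] := ray_Up rHX dk.
(* A graft at the source rung of level [k.+1 + j] forces one at the rung of its image
   [Sp a (m + j)]; aperiodicity then excludes a shift of levels. *)
have pattern j : col (k.+1 + j) = ~~ c -> col (m + j) = ~~ a.
  move=> cj; have [y [l [_ rg kg ng]]] := graft_next_to_rung cj.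
  have := (up j).2; rewrite /H ht -addSn => kt.
  have [b eb] : exists b, val (f (r (k.+1 + j))) = rcons (val (f (t (k.+1 + j)))) b.
    case/adjP: (adj_tr (k.+1 + j)) => // -[b eb].
    by have [_ [? [? []]]] := H_child (H_r _) (H_t _) eb; rewrite kt.
  have [b0 [a' [l' [kr [|]]]]] := H_child (H_t _) (H_r _) eb; rewrite kt // => -[ea el].
  case/adjP: rg => -[d ed]; last by rewrite (parent_uniq eb ed) eqxx in ng.
  have := kind_child ed; rewrite kr kg -ea -el /=; case: d ed => // _.
  by case: eqP.
have [ea ekm] := col_shift pattern; subst a m.
have [kx _] := up 0; rewrite !addn0 in kx.
have [b eb] := dk.
have Hk := ray_H rHX k.
have full_Hk : full (H k) by have [] := rHX k.
have at_k : H k = f (t k) by rewrite /H ht.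
have prev_adj : adj (H k) (f (spv c k)).
  by rewrite at_k; apply: fhom; rewrite adj_sym; apply: (adj_child (b := true)).
have prev_ne : f (spv c k) != X k.
  rewrite /X xs (inj_eq finj); apply/eqP => /(congr1 (size \o val)).
  by rewrite [LHS]size_sp [RHS]size_sp doubleS => /eqP; rewrite ltn_eqF.
have prev_nH : ~~ isH (kind (f (spv c k))).
  apply/negP => hH; have e : f (spv c k) = f (r k).
    by apply: (H_nbr_uniq Hk) => //; [rewrite at_k adj_tr|apply: H_r].
  by move: e => /finj/(congr1 (size \o val)) /=; rewrite !size_rcons => /eqP; rewrite ltn_eqF.
have : kind (H k) = Sp c k \/ kind (H k) = Rg (~~ c) k.
  move: (kind_child eb) Hk; rewrite kx.
  case: (kind (H k)) => //= [a|a n|a n|a [|n]].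
  - by case: b {eb} => //= -[].
  - by case: b {eb} => // -[-> ->]; left.
  - case: b {eb} => //; last by case: ifP.
    by case=> <- <-; rewrite negbK; right.
  - by [].
  - by case: b {eb}.
case=> kH.
(* An [Sp c k] with positive [k] would be reached from its right child, through which the ray also
   leaves; for [k = 0] this kind does not occur in the other tree. *)
- case: k => [|i] in dk mk up pattern kx eb Hk full_Hk at_k prev_adj prev_ne prev_nH kH *.
    have := low_root (run_state_at (H 0)); rewrite /low -/(kind (H 0)) kH => -[] // [].
    by case: (c).
  have [b' [d [_ ed]]] := not_descends rHX (mk i (ltnSn i)).
  have [_ _ _ ne _] := rHX i.
  have true_child j e : val (X j) = rcons (val (H i.+1)) e -> e = true.
    move=> ej; have := kind_child ej; rewrite kH; case: e {ej} => // -[kj].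
    by have := ray_nH rHX j; rewrite -/X -kj.
  case/eqP: ne; apply: val_inj; rewrite -!/(X _).
  by rewrite ed eb (true_child _ _ ed) (true_child _ _ eb).
pose Q := f (r k).
have HQ : adj (H k) Q by rewrite at_k adj_tr.
have [d ed] : exists d, val (H k) = rcons (val Q) d.
  case/adjP: HQ => // -[d ed].
  by have [_ [? [? [_ []]]]] := H_child Hk (H_r k) ed; rewrite kH.
have [_ [a' [n' [kr kQ]]]] := H_child (H_r k) Hk ed.
move: kr kQ; rewrite kH => -[<- <-] {a' n'} kQ.
case ck: (col k == c); last first.
(* The graft at [r k] must go to the link above [Q]. A second ray, leaving [r k] through its right
   child, cannot descend from the [Ar] at [Q] by [ray_Up], so it needs the same link. *)
- have {}ck : col k = ~~ c by case: (col k) ck; case: (c).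
  have [y [l [ey rg kg ng]]] := graft_next_to_rung ck.
  have parent_y : kind Q = Ar (~~ c) k.+1 /\ exists e, val Q = rcons (val (f y)) e.
    case/adjP: rg => -[e ee]; have := kind_child ee; rewrite kg.
      by case: kQ => ->; case: e {ee}.
    case: kQ => -> //; last by split=> //; exists e.
    by case: e {ee}.
  case: parent_y => kQ' [e ee].
  have [h' [x' [rhx' hxE']]] : exists h' x' : nat -> tree c, ray h' x' /\
    forall i, val (h' i) = iter i (fun u => rcons (rcons u true) true) (val (r k)) /\
      val (x' i) = rcons (iter i (fun u => rcons (rcons u true) true) (val (r k))) true.
    apply: (@source_ray c (fun i => iter i (fun u => rcons (rcons u true) true) (val (r k)))
              (~~ c) k.+1) => [//||z ez].
    + by rewrite run_rcons [run _ _ _]run_Rg.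
    + by have -> : z = r k; [apply: val_inj|apply: full_r].
  have h0 : h' 0 = r k by apply: val_inj; rewrite (hxE' 0).1.
  have rHX' := ray_hom finj fhom rhx'.
  have [h1 _ _ _ _] := rHX' 0.
  case/adjP: h1 => -[b' eb'].
    have [a' [m' /(_ 0)[kx' _]]] := ray_Up rHX' (ex_intro _ b' eb').
    rewrite /= in kx'; have := kind_child eb'; rewrite /= h0 -/Q kQ' kx'.
    by case: b' {eb'}.
  rewrite /= h0 in eb'.
  have /finj exy := parent_uniq eb' ee.
  have := (hxE' 0).2; rewrite exy ey => /rcons_inj[].
  by [].
move/eqP: ck => ck.
have eb1 : b = true.
  by have := kind_child eb; rewrite kH kx /=; case: (b) => //; case: ifP.
(* The right child of [H k] is taken by [X k] and its parent is the hub [Q], which leaves the left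
   child. *)
have eprev : val (f (spv c k)) = rcons (val (H k)) false.
  case/adjP: prev_adj => -[e ee].
    case: e ee => // ee; case/eqP: prev_ne; apply: val_inj; by rewrite ee eb eb1.
  by case/negP: prev_nH; rewrite (parent_uniq ee ed); apply: H_r.
have kprev : kind (f (spv c k)) = Gr k.
  by have := kind_child eprev; rewrite kH /= negbK ck eqxx => -[].
have h0 : addr tab (Ar c k) [::] by [].
pose x0 := vertex_at (addr_al h0).
have size_x0 : size (val x0) < size (sp k) by rewrite [val x0]/(al k [::]) al_nil_lt.
(* Degree 3 keeps the image of the root of [Ar c k] off the stalk, so that it is the root of the
   pruned copy, contradicting [no_pruned_image]. *)
have d0 : deg_ge 3 x0.
  case ek: k @x0 size_x0 => [|i] x0 _.
    by apply: (@deg3I _ x0 [::] true) => //; rewrite (@state_atE _ x0 [:: true] (Base c)).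
  suff -> : x0 = t i by apply: nbrs3_deg (full_t i).
  by apply: val_inj; rewrite /= cats1.
have a0 : adj (f (spv c k)) (f x0).
  apply: fhom; rewrite adj_sym /= /tadj /= -[sp k]cats0.
  by rewrite (wadj_al_sp [::] h0).
have n0 : f x0 != H k.
  rewrite at_k (inj_eq finj); apply/eqP => e; move: size_x0; rewrite e /= size_rcons.
  by rewrite ltnNge leqnSn.
case/adjP: a0 => -[e ee]; last by rewrite (parent_uniq ee eprev) eqxx in n0.
case: e ee => ee; first exact: (@no_pruned_image k x0 (spv c k)).
have := deg3_two (deg_ge_hom finj fhom d0).
by have := kind_child ee; rewrite kprev => -[<-].
Qed.

End NoEmbedding.

Theorem mainTheorem2 :
  exists T S : sgraph,
    [/\ is_tree T /\ is_tree S,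
        infinite_graph T /\ infinite_graph S,
        has_max_degree T 3 /\ has_max_degree S 3,
        vertex_hypomorphic T S /\ edge_hypomorphic T S
      & ~ embeds T S /\ ~ embeds S T].
Proof.
exists (tree false), (tree true); split.
- by split; apply: tree_is_tree.
- by split; apply: tree_infinite.
- by split; apply: tree_degree.
- by split; [exact: trees_vertex_hypomorphic|exact: trees_edge_hypomorphic].
- by split=> -[f finj fhom]; [apply: (@no_embedding false f)|apply: (@no_embedding true f)].
Qed.
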